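(* There exists an absolute constant $C>0$ such that the following holds. For every positive sequence $(b_n)_{n\ge1}$ satisfying $b_n=o(\sqrt n)$ as $n\to\infty$, there is $n_0$ (depending on the sequence) such that for all $n\ge n_0$ and all $0\le x\le b_n$, $$\left|\log\frac{\mathbb P(Y_n>x)}{\overline\Phi(x)}\right|\le C\Delta_n(x)$$ and $$\left|\log\frac{\mathbb P(Y_n<-x)}{\overline\Phi(x)}\right|\le C\Delta_n(x).$$ The second estimate remains valid if the strict inequality $Y_n<-x$ is replaced by $Y_n\le -x$.
   Context: Every $x\in(0,1)$ has a unique (infinite) Engel expansion $x=\frac1{q_1}+\frac1{q_1q_2}+\cdots+\frac1{q_1q_2\cdots q_n}+\cdots$ with integer digits $q_n=q_n(x)$ satisfying $q_{n+1}\ge q_n\ge2$. The expanded number is taken uniformly distributed on $(0,1)$, which makes the $q_n$ random variables. It is known that $(q_n)_{n\ge1}$ is then a time-homogeneous Markov chain on $\{2,3,\ldots\}$ with transition probabilities $\mathbb P(q_n=k\mid q_{n-1}=j)=\frac{j-1}{k(k-1)}$ for $k\ge j\ge2$, and initial distribution $\mathbb P(q_1=k)=\frac1{k(k-1)}$, $k\ge2$. Notation: $Y_n:=\frac{\log q_n-n}{\sqrt n}$; $\Phi$ is the standard normal distribution function and $\overline\Phi(x):=1-\Phi(x)$. For $n\ge3$ and $x\ge0$, $\Delta_n(x):=\frac{x^3}{\sqrt n}+\frac{(1+x)\log n}{\sqrt n}$. *)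

(* Defs.v *)
From HB Require Import structures.
From mathcomp Require Import all_boot all_order all_algebra.
From mathcomp Require Import all_classical all_reals all_analysis.

Set Implicit Arguments.
Unset Strict Implicit.
Unset Printing Implicit Defensive.

Import Order.TTheory GRing.Theory Num.Theory.
Import numFieldNormedType.Exports.

Local Open Scope classical_set_scope.
Local Open Scope ring_scope.

(* The digits are indexed from 0 here: [e i] is the usual q_{i+1}, so that the
   n-th term of the series is 1 / (q_1 ... q_{n+1}). *)
Definition is_engel_expansion (R : realType) (x : R) (e : nat -> nat) : Prop :=
  [/\ forall i, (2 <= e i)%N,
      forall i, (e i <= e i.+1)%N &
      series (fun n => (\prod_(i < n.+1) ((e i)%:R : R))^-1) @ \oo --> x].

(* For 0 < x < 1 the expansion exists and is unique, so [xget] selects it; the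
   default is used only for x <= 0 or x > 1, a null set for the uniform law. *)
Definition engel_expansion (R : realType) (x : R) : nat -> nat :=
  xget (fun=> 2%N) [set e | is_engel_expansion x e].

(* q_n(x) with the usual indexing, meaningful for n >= 1. *)
Definition engel_digit (R : realType) (n : nat) (x : R) : nat :=
  engel_expansion x n.-1.

Definition unif01 (R : realType) : probability (measurableTypeR R) R :=
  uniform_prob (@ltr01 R).

Definition engelY (R : realType) (n : nat) (x : R) : R :=
  (ln (engel_digit n x)%:R - n%:R) / Num.sqrt n%:R.

Definition Phi (R : realType) (x : R) : \bar R := normal_prob 0 1 `]-oo, x].

Definition Phibar (R : realType) (x : R) : \bar R := (1 - Phi x)%E.

Definition Delta (R : realType) (n : nat) (x : R) : R :=
  x ^+ 3 / Num.sqrt n%:R + (1 + x) * ln n%:R / Num.sqrt n%:R.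

(* Main.v *)
Require Import Defs.
From HB Require Import structures.
From mathcomp Require Import all_boot all_order all_algebra.
From mathcomp Require Import all_classical all_reals all_analysis.
From mathcomp Require Import ring lra zify.

Import Order.TTheory GRing.Theory Num.Theory.
Import numFieldNormedType.Exports.

Local Open Scope classical_set_scope.
Local Open Scope ring_scope.

(** Why the theorem is true.

    In the Engel expansion of a uniform point, the numbers of occurrences of
    the digits 2, 3, 4, ... are independent geometric variables, the digit k
    having ratio 1/k.  As the digits do not decrease, q_n > N means that the
    total number T of digits at most N is less than n.  In terms of the complete
    homogeneous symmetric polynomials h_m in 1/2, ..., 1/N this reads
    P(q_n > N) = (h_0 + ... + h_(n-1)) / N.  [engel_digit_tail] proves the
    formula directly: the event is an explicit finite union of disjoint
    intervals, obtained by recursion on the first digit.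

    Since 1/(1 - a z) = e^(a z) * (e^(- a z) / (1 - a z)) and the second factor
    has nonnegative coefficients, T is the sum of a Poisson variable of mean
    L = 1/2 + ... + 1/N ([harm]) and of an independent X >= 0 with
    E (1 + t)^X <= e^(2 t) for 0 <= t <= 1/2, uniformly in N.  Adding X changes
    the two Poisson tails at n by a factor 1 + O(hazard rate)
    ([engel_tail_le], [engel_tail_ge], [engel_head_le]), and the hazard rates at
    n are O((1 + x) / sqrt n) ([poisQ_hazard], [poisB_hazard_rate]).  The
    threshold is ln N = n + x sqrt n or n - x sqrt n up to O(1), so L lies
    within O(1) of it.

    It remains to compare P(Poi(L) < n) and P(Poi(L) >= n) with the normal tail.
    As functions of L they are the tails of a Gamma law, with an explicit
    density.  After the change of variables L = n e^s, or L = (n-1)(1 + h), the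
    Gamma density is a constant times exp(-n (e^s - 1 - s)), or
    exp(-(n-1) (h - ln(1 + h))); on each side of the centre one of the two is
    dominated by, and the other dominates, the matching Gaussian exponential, so
    that the difference between the Gamma tail and a normal tail is monotone and
    vanishes at the end of the half-line.  This gives four one-sided comparisons
    without any asymptotic expansion ([poisQ_le_ntail], [poisB_ge_ntail],
    [poisQ_ge_ntail], [poisB_le_ntail]); read at the centre, where the two tails
    add up to 1, they also give Stirling's formula for the normalising constant
    ([stirling_le], [stirling_ge]).  The argument of the normal tail so obtained
    differs from x by O((1 + x^2) / sqrt n), which by Mills' ratio
    ([ntail_shift]) costs a factor exp(O((1 + x)(1 + x^2) / sqrt n)).  Altogether
    the logarithm of each ratio is O((x^3 + x + 1) / sqrt n), and this is at most
    a constant times Delta. *)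

(** * Monotonicity from derivatives *)

Section Calculus.
Context {R : realType}.
Implicit Types (f g df : R -> R) (a b c x : R).

(** Same content as [is_derive], hidden from its type-class resolution: the
    derivative is computed by the syntax-directed [der] below. *)
Definition has_derive f x a : Prop := is_derive x 1 f a.

Lemma derive_le0_nincr f df a b : a <= b ->
  (forall x, a <= x <= b -> has_derive f x (df x)) ->
  (forall x, a <= x <= b -> df x <= 0) -> f b <= f a.
Proof.
move=> ab fd f0.
have [|||c] := @MVT_segment _ f df a b => //.
- by move=> x; rewrite in_itv => /andP[/ltW ? /ltW ?]; apply/fd/andP.
- apply: derivable_within_continuous => x; rewrite in_itv/= => xab.
  by have := fd x xab; case.
rewrite in_itv/= => cab E; rewrite -subr_le0 E.
by rewrite mulr_le0_ge0 ?f0 ?subr_ge0.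
Qed.

Lemma derive_ge0_ndecr f df a b : a <= b ->
  (forall x, a <= x <= b -> has_derive f x (df x)) ->
  (forall x, a <= x <= b -> 0 <= df x) -> f a <= f b.
Proof.
move=> ab fd f0; rewrite -lerN2.
apply: (@derive_le0_nincr (\- f) (\- df) a b ab) => x xab.
- exact: (is_deriveN (fd x xab)).
- by rewrite /= oppr_le0 f0.
Qed.

(** How two tails are compared below: their difference is monotone and tends
    to 0, or to something nonnegative, at infinity. *)
Lemma derive_le0_ge0 f df a :
  (forall x, a <= x -> has_derive f x (df x)) ->
  (forall x, a <= x -> df x <= 0) ->
  (forall e, 0 < e -> exists M, forall x, M <= x -> - e <= f x) -> 0 <= f a.
Proof.
move=> fd f0 fl; apply/ler_addgt0Pl => e e0; have [M fM] := fl e e0.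
have : f (Num.max a M) <= f a.
  apply: (@derive_le0_nincr f df); first by rewrite le_max lexx.
  - by move=> x /andP[ax _]; exact: fd.
  - by move=> x /andP[ax _]; exact: f0.
have : - e <= f (Num.max a M) by apply: fM; rewrite le_max lexx orbT.
by lra.
Qed.

Lemma has_derive_cst c x : has_derive (fun=> c) x 0.
Proof. exact: is_derive_cst. Qed.

Lemma has_derive_id x : has_derive (fun y => y) x 1.
Proof. exact: is_derive_id. Qed.

Lemma has_deriveD f g x a b : has_derive f x a -> has_derive g x b ->
  has_derive (fun y => f y + g y) x (a + b).
Proof. by rewrite /has_derive => ? ?; exact: is_deriveD. Qed.

Lemma has_deriveN f x a : has_derive f x a -> has_derive (fun y => - f y) x (- a).
Proof. by rewrite /has_derive => ?; exact: is_deriveN. Qed.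

Lemma has_deriveM f g x a b : has_derive f x a -> has_derive g x b ->
  has_derive (fun y => f y * g y) x (a * g x + f x * b).
Proof.
rewrite /has_derive => fa gb; have := is_deriveM fa gb.
by rewrite /GRing.scale /= addrC [g x * a]mulrC.
Qed.

Lemma has_deriveX f n x a : has_derive f x a ->
  has_derive (fun y => f y ^+ n) x (n%:R * f x ^+ n.-1 * a).
Proof.
move=> fa; elim: n => [|n IH].
  by rewrite !mul0r; under eq_fun do rewrite expr0; exact: has_derive_cst.
under eq_fun do rewrite exprS.
have := has_deriveM f _ x _ _ fa IH; congr has_derive.
case: n {IH} => [|n] /=; first by rewrite !expr0; ring.
by rewrite -[n.+2%:R]natr1 exprS; ring.
Qed.

Lemma has_deriveV f x a : f x != 0 -> has_derive f x a ->
  has_derive (fun y => (f y)^-1) x (- (f x) ^- 2 * a).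
Proof. by rewrite /has_derive => *; exact: is_deriveV. Qed.

Lemma has_derive_comp f g x a b : has_derive f (g x) a -> has_derive g x b ->
  has_derive (fun y => f (g y)) x (a * b).
Proof. by rewrite /has_derive => fa gb; have := @is_derive1_comp _ f g x a b fa gb. Qed.

Lemma has_derive_expR f x a : has_derive f x a ->
  has_derive (fun y => expR (f y)) x (expR (f x) * a).
Proof. by move=> fa; apply: has_derive_comp fa; exact: is_derive_expR. Qed.

Lemma has_derive_eq f x a b : has_derive f x a -> a = b -> has_derive f x b.
Proof. by move=> ? <-. Qed.

End Calculus.

(** [der] differentiates along the syntax of the function; what remains are the
    derivatives of its non-elementary parts, and the equality between the
    computed derivative and the stated one. *)
Ltac der_step := match goal with
 | |- has_derive (fun _ => ?c) _ _ => apply: has_derive_cst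
 | |- has_derive (fun y => y) _ _ => apply: has_derive_id
 | |- has_derive (fun y => @?f y + @?g y) _ _ => apply: (@has_deriveD _ f g)
 | |- has_derive (fun y => - @?f y) _ _ => apply: (@has_deriveN _ f)
 | |- has_derive (fun y => @?f y * @?g y) _ _ => apply: (@has_deriveM _ f g)
 | |- has_derive (fun y => @?f y ^+ ?n) _ _ => apply: (@has_deriveX _ f n)
 | |- has_derive (fun y => (@?f y)^-1) _ _ => apply: (@has_deriveV _ f)
 | |- has_derive (fun y => expR (@?f y)) _ _ => apply: (@has_derive_expR _ f)
 end.
Ltac der := apply: has_derive_eq; first (repeat der_step).

(** * The normal tail *)

Section Normal.
Context {R : realType}.
Implicit Types (x y a b : R).

Definition npdf x : R := normal_pdf 0 1 x.
(** [Phibar] has extended real values; differentiating needs a real function. *)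
Definition ntail x : R := fine (Phibar x).

Lemma npdfE x : npdf x = npdf 0 * expR (- (x ^+ 2 / 2)).
Proof.
rewrite /npdf !normal_pdfE ?oner_neq0//= /normal_fun expr1n !subr0.
by rewrite expr0n /= oppr0 mul0r expR0 mulr1 mulNr.
Qed.

Lemma npdf_gt0 x : 0 < npdf x.
Proof.
by rewrite /npdf normal_pdfE ?oner_neq0//= mulr_gt0 ?expR_gt0 ?normal_peak_gt0 ?oner_neq0.
Qed.

Lemma PhibarE x : Phibar x = (ntail x)%:E.
Proof.
rewrite /ntail /Phibar fineK // /Phi.
by rewrite fin_numB /= fin_num_measure.
Qed.

Let P := normal_prob (0:R) 1.
Let F x : R := fine (P `]-oo, x]).

Let ntailF x : ntail x = 1 - F x.
Proof. by rewrite /ntail /Phibar /Phi -/P fineB ?fin_num_measure. Qed.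

Lemma has_derive_ntail x : has_derive ntail x (- npdf x).
Proof.
have -> : ntail = (fun=> 1) - F by apply/funext => y; rewrite ntailF.
rewrite -[- npdf x]add0r; apply: is_deriveB.
have [||||d1 d2] := @continuous_FTC1 R (normal_pdf 0 1) -oo%O x (x+1).
- by rewrite ltrDl.
- exact: (integrableS _ _ (@subsetT _ _) (integrable_normal_pdf _ _)).
- by rewrite ltNyr.
- by apply: continuous_normal_pdf; rewrite oner_neq0.
have FE : F = fun x => (\int[lebesgue_measure]_(t in `]-oo, x]) normal_pdf 0 1 t)%R by [].
rewrite FE; split; first exact: d1.
by rewrite -derive1E; exact: d2.
Qed.

Lemma ntail_le1 x : ntail x <= 1.
Proof.
rewrite ntailF; have : 0 <= F x by rewrite /F fine_ge0//.
by lra.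
Qed.

Let idTR : measurableTypeR R -> R := idfun.
#[local] HB.instance Definition _ :=
  @isMeasurableFun.Build _ _ _ _ idTR (@measurable_id _ _ setT).

Lemma ntail_small e : 0 < e -> exists M, forall x, M <= x -> ntail x <= e.
Proof.
move=> e0.
have /fine_cvgP[_ /cvgrPdist_le /(_ e e0)] := cvg_cdfy1 (idTR : {RV P >-> R}).
move=> [M [_ /= HM]]; exists (M + 1) => x Mx.
have := HM x ltac:(lra).
rewrite ntailF; apply: le_trans.
exact: ler_norm.
Qed.

Lemma ntailNsmall e : 0 < e -> exists M, forall x, x <= M -> 1 - ntail x <= e.
Proof.
move=> e0.
have /fine_cvgP[_ /cvgrPdist_le /(_ e e0)] := cvg_cdfNy0 (idTR : {RV P >-> R}).
move=> [M [_ /= HM]]; exists (M - 1) => x Mx.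
have := HM x ltac:(lra).
rewrite ntailF sub0r normrN; apply: le_trans.
rewrite opprB addrCA subrr addr0. exact: ler_norm.
Qed.

Lemma ntail_ge0 x : 0 <= ntail x.
Proof.
rewrite ntailF subr_ge0 -lee_fin fineK ?fin_num_measure//.
exact: probability_le1.
Qed.

Lemma npdf_le0 x : npdf x <= npdf 0.
Proof.
rewrite npdfE ler_piMr ?expR_le1 ?oppr_le0 ?divr_ge0 ?sqr_ge0//.
all: exact/ltW/npdf_gt0.
Qed.

(** Mills' ratio: ntail x - npdf x / (x + 1) tends to 0 at infinity and has the
    nonpositive derivative - npdf x * x / (x + 1) ^ 2. *)
Lemma npdf_le_ntail x : 0 <= x -> npdf x <= (x + 1) * ntail x.
Proof.
move=> x0.
pose f y := ntail y - npdf y * (y + 1)^-1.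
pose df y := - npdf y * (1 - ((y + 1) ^- 2 + y * (y + 1)^-1)).
suff : 0 <= f x.
  by rewrite /f subr_ge0 ler_pdivrMr; [rewrite mulrC|lra].
apply: (@derive_le0_ge0 _ f df) => [y xy|y xy|e e0].
- have y1 : y + 1 != 0 by rewrite gt_eqF//; lra.
  have -> : f = (fun y => ntail y - npdf 0 * expR (- (y^+2/2)) * (y + 1)^-1).
    by apply/funext => z; rewrite /f [npdf z]npdfE.
  der => //; first exact: has_derive_ntail.
  rewrite /df [npdf y]npdfE /= /GRing.scale /=.
  by field.
- rewrite /df /= mulNr oppr_le0; apply: mulr_ge0; first exact/ltW/npdf_gt0.
  have -> : 1 - ((y + 1) ^- 2 + y * (y + 1)^-1) = y * (y + 1) ^- 2.
    by field; rewrite gt_eqF//; lra.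
  by rewrite mulr_ge0 ?invr_ge0 ?exprn_ge0//; lra.
- exists (Num.max 0 (npdf 0 / e)) => z; rewrite ge_max => /andP[z0].
  rewrite ler_pdivrMr// => ze; rewrite /f.
  have : npdf z * (z + 1)^-1 <= e; last by have := ntail_ge0 z; lra.
  rewrite ler_pdivrMr; last by lra.
  by have := npdf_le0 z; nra.
Qed.

Lemma ntail_nincr x y : x <= y -> ntail y <= ntail x.
Proof.
move=> xy; apply: (@derive_le0_nincr _ ntail (fun z => - npdf z)) => // z _.
- exact: has_derive_ntail.
- by rewrite oppr_le0 ltW ?npdf_gt0.
Qed.

Lemma ntail_gt0 x : 0 < ntail x.
Proof.
have p y : 0 <= y -> 0 < ntail y.
  by move=> y0; have := npdf_le_ntail y y0; have := npdf_gt0 y; nra.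
have [/p//|x0] := leP 0 x.
exact: lt_le_trans (p 0 (lexx 0)) (ntail_nincr x 0 (ltW x0)).
Qed.

(** The derivative of ln ntail at y is - npdf y / ntail y.  It is at least - (b + 1)
    on the whole half-line y <= b, for b >= 0, by Mills' ratio for y >= 0 and by
    npdf y <= npdf 0 <= ntail 0 <= ntail y for y < 0. *)
Lemma ntail_shift a b : a <= b -> 0 <= b ->
  ntail a <= ntail b * expR ((b - a) * (b + 1)).
Proof.
move=> ab b0.
pose f y := ntail y * expR ((y - b) * (b + 1)).
pose df y := expR ((y - b) * (b + 1)) * ((b + 1) * ntail y - npdf y).
have : f a <= f b.
  apply: (@derive_ge0_ndecr _ f df) => // y /andP[ay yb].
  - rewrite /f; der; first exact: has_derive_ntail.
    by rewrite /df /GRing.scale /=; ring.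
  - rewrite /df /=; apply: mulr_ge0; first exact: expR_ge0.
    rewrite subr_ge0; have [y0|y0] := leP 0 y.
      by have := npdf_le_ntail y y0; have := ntail_gt0 y; nra.
    have := npdf_le_ntail 0 (lexx _); have := npdf_le0 y.
    by have := ntail_nincr y 0 (ltW y0); have := ntail_gt0 y; nra.
rewrite /f subrr mul0r expR0 mulr1 => fab.
rewrite -[b - a]opprB mulNr expRN ler_pdivlMr ?expR_gt0//.
Qed.

Lemma npdfN x : npdf (- x) = npdf x.
Proof. by rewrite npdfE [RHS]npdfE sqrrN. Qed.

(** The sum of the two tails has derivative 0, and tends to 1. *)
Lemma ntailN x : ntail (- x) = 1 - ntail x.
Proof.
pose f y := ntail y + ntail (- y).
have fE y : f y = f 0.
  apply: (@is_derive_0_is_cst _ f) => z; rewrite -/(has_derive f z 0) /f.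
  der; first exact: has_derive_ntail.
    by apply: (@has_derive_comp _ ntail (fun y => - y)); [exact: has_derive_ntail|repeat der_step].
  by rewrite npdfN; ring.
suff f1 : f 0 = 1 by have := fE x; rewrite f1 /f => <-; lra.
apply/eqP; rewrite eq_le; apply/andP; split; apply/ler_addgt0Pl => e e0.
- have [M HM] := ntail_small e e0.
  rewrite -(fE (Num.max 0 M)) /f.
  have := HM (Num.max 0 M); rewrite le_max lexx orbT => /(_ isT).
  by have := ntail_le1 (- Num.max 0 M); lra.
- have [M HM] := ntailNsmall e e0.
  rewrite -(fE M) /f.
  by have := HM M (lexx _); have := ntail_ge0 (- M); lra.
Qed.

Lemma ntail0 : ntail 0 = 2^-1.
Proof. by have := ntailN 0; rewrite oppr0; lra. Qed.

Lemma npdf0_le : npdf 0 <= 2^-1.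
Proof. by have := npdf_le_ntail 0 (lexx 0); rewrite ntail0; lra. Qed.
End Normal.

(** * Inequalities for the exponential *)

Section ExpIneq.
Context {R : realType}.
Implicit Types (s h : R).

Lemma expR_ge_quad s : 0 <= s -> 1 + s + s ^+ 2 / 2 <= expR s.
Proof.
move=> s0; rewrite -subr_ge0.
have E : 0 = expR 0 - (1 + 0 + 0 ^+ 2 / 2) :> R by rewrite expR0; ring.
rewrite E.
apply: (@derive_ge0_ndecr R (fun y => expR y - (1 + y + y ^+ 2 / 2))
  (fun y => expR y - (1 + y)) _ _ s0) => y _.
- by der; rewrite /=; field.
- by rewrite subr_ge0 expR_ge1Dx.
Qed.

Lemma expR_le_quad s : s <= 0 -> expR s <= 1 + s + s ^+ 2 / 2.
Proof.
move=> s0; rewrite -subr_ge0 -oppr_le0 opprB.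
have E : 0 = expR 0 - (1 + 0 + 0 ^+ 2 / 2) :> R by rewrite expR0; ring.
rewrite E.
apply: (@derive_ge0_ndecr R (fun y => expR y - (1 + y + y ^+ 2 / 2))
  (fun y => expR y - (1 + y)) _ _ s0) => y _.
- by der; rewrite /=; field.
- by rewrite subr_ge0 expR_ge1Dx.
Qed.

(** The derivative is h ^ 2 * exp(- h + h ^ 2 / 2).  Comparing with the value at
    h = 0 decides the sign of h - ln(1 + h) - h ^ 2 / 2 on each side of 0. *)
Lemma onePexp_ndecr h1 h2 : h1 <= h2 ->
  (1 + h1) * expR (- h1 + h1 ^+ 2 / 2) <= (1 + h2) * expR (- h2 + h2 ^+ 2 / 2).
Proof.
move=> h12.
apply: (@derive_ge0_ndecr R (fun y => (1 + y) * expR (- y + y ^+ 2 / 2))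
  (fun y => y ^+ 2 * expR (- y + y ^+ 2 / 2)) _ _ h12) => y _.
- by der; rewrite /=; field.
- by rewrite mulr_ge0 ?sqr_ge0 ?expR_ge0.
Qed.

Lemma onePexp0 : (1 + 0) * expR (- 0 + 0 ^+ 2 / 2) = 1 :> R.
Proof. by rewrite expr0n /= mul0r oppr0 !addr0 expR0 mulr1. Qed.

Lemma onePexp_ge h : 0 <= h -> expR (- (h ^+ 2 / 2)) <= (1 + h) * expR (- h).
Proof.
move=> h0; have := onePexp_ndecr 0 h h0.
rewrite onePexp0 expRD mulrA.
by move=> H; rewrite expRN -[_^-1]mul1r ler_pdivrMr ?expR_gt0.
Qed.

Lemma onePexp_le h : h <= 0 -> (1 + h) * expR (- h) <= expR (- (h ^+ 2 / 2)).
Proof.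
move=> h0; have := onePexp_ndecr h 0 h0.
rewrite onePexp0 expRD mulrA.
by move=> H; rewrite [leRHS]expRN -[leRHS]mul1r ler_pdivlMr ?expR_gt0.
Qed.

Lemma onePexp_le1 h : (1 + h) * expR (- h) <= 1.
Proof. by rewrite expRN ler_pdivrMr ?expR_gt0// mul1r expR_ge1Dx. Qed.

End ExpIneq.

(** * Comparison of the Poisson and normal tails *)

Section Poisson.
Context {R : realType}.
Implicit Types (L s y r e : R) (m n : nat).

(** The probability that a Poisson variable of mean L equals m; as a function of
    L, the density of the Gamma law of shape m + 1. *)
Definition pois m L : R := expR (- L) * L ^+ m / m`!%:R.
(** P(Poi(L) < n), and then P(Poi(L) >= n). *)
Definition poisQ n L : R := \sum_(i < n) pois i L.
Definition poisB n L : R := 1 - poisQ n L.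

Lemma pois_ge0 m L : 0 <= L -> 0 <= pois m L.
Proof. by move=> L0; rewrite /pois divr_ge0 ?mulr_ge0 ?expR_ge0 ?exprn_ge0. Qed.

Lemma pois_gt0 m L : 0 < L -> 0 < pois m L.
Proof. by move=> L0; rewrite /pois divr_gt0 ?mulr_gt0 ?expR_gt0 ?exprn_gt0 ?ltr0n ?fact_gt0. Qed.

Lemma fact_neq0 m : (m`!%:R : R) != 0.
Proof. by rewrite pnatr_eq0 -lt0n fact_gt0. Qed.

Lemma poisS m L : pois m.+1 L * m.+1%:R = L * pois m L.
Proof.
rewrite /pois factS natrM exprS.
have : m.+1%:R != 0 :> R by rewrite pnatr_eq0.
by move: (m.+1%:R : R) => k k0; field; rewrite ?k0 ?fact_neq0.
Qed.

Lemma has_derive_pois m L : has_derive (pois m.+1) L (pois m L - pois m.+1 L).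
Proof.
rewrite /pois; der; rewrite /GRing.scale /= factS natrM exprS.
have : m.+1%:R != 0 :> R by rewrite pnatr_eq0.
by move: (m.+1%:R : R) => k k0; field; rewrite ?k0 ?fact_neq0.
Qed.

(** The derivatives of the point masses telescope: P(Poi(L) < m + 1) is the upper
    tail at L of the Gamma law of shape m + 1. *)
Lemma has_derive_poisQ m L : has_derive (poisQ m.+1) L (- pois m L).
Proof.
elim: m => [|m IH].
  rewrite /poisQ; under eq_fun do rewrite big_ord1.
  by rewrite /pois; der; rewrite /GRing.scale /= fact0 expr0; field.
have -> : poisQ m.+2 = fun y => poisQ m.+1 y + pois m.+1 y.
  by apply/funext => y; rewrite /poisQ big_ord_recr.
apply: has_derive_eq; first exact: (has_deriveD _ _ _ _ _ IH (has_derive_pois m L)).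
by ring.
Qed.

Lemma poisQ0 m : poisQ m.+1 0 = 1.
Proof.
rewrite /poisQ big_ord_recl big1 ?addr0; first by rewrite /pois oppr0 expR0 fact0 divr1 mulr1.
by move=> i _; rewrite /pois exprS mul0r mulr0 mul0r.
Qed.

Lemma poisQ_ge0 n L : 0 <= L -> 0 <= poisQ n L.
Proof. by move=> L0; apply: sumr_ge0 => i _; exact: pois_ge0. Qed.

Lemma poisQ_nincr m L1 L2 : 0 <= L1 -> L1 <= L2 -> poisQ m.+1 L2 <= poisQ m.+1 L1.
Proof.
move=> L0 L12; apply: (@derive_le0_nincr _ _ (fun y => - pois m y)) => // y /andP[y1 _].
  exact: has_derive_poisQ.
by rewrite oppr_le0 pois_ge0// (le_trans L0).
Qed.

Lemma poisQ_le1 n L : 0 <= L -> poisQ n L <= 1.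
Proof.
case: n => [|n] L0; first by rewrite /poisQ big_ord0.
by rewrite -(poisQ0 n) poisQ_nincr.
Qed.

Lemma poisB_ge0 n L : 0 <= L -> 0 <= poisB n L.
Proof. by move=> L0; rewrite /poisB subr_ge0 poisQ_le1. Qed.

Lemma pois_le1 m L : 0 <= L -> pois m L <= 1.
Proof.
move=> L0; have := poisQ_le1 m.+1 L L0; rewrite /poisQ big_ord_recr /=.
have : 0 <= \sum_(i < m) pois i L by exact: poisQ_ge0.
by rewrite -/(poisQ m L); lra.
Qed.

Lemma pois_small m L : 0 < L -> pois m L <= m.+1%:R / L.
Proof.
move=> L0; rewrite ler_pdivlMr// mulrC -poisS ler_piMl// pois_le1//.
exact: ltW.
Qed.

Lemma poisQ_small n L : 0 < L -> poisQ n L <= n%:R * n%:R / L.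
Proof.
move=> L0; rewrite -mulrA mulr_natl -[X in _ *+ X]card_ord -sumr_const.
apply: ler_sum => i _; apply: le_trans (pois_small i L L0) _.
by rewrite ler_pM2r ?invr_gt0// ler_nat.
Qed.

Lemma pois_scale m L r : 0 < L -> pois m (L * r) = pois m L * (r ^+ m * expR (L - L * r)).
Proof.
move=> L0; rewrite /pois exprMn expRD.
have := expRxMexpNx_1 L; set a := expR L; set b := expR (- L) => ab.
transitivity (expR (- (L * r)) * (L ^+ m * r ^+ m) / m`!%:R * (a * b)); first by rewrite ab mulr1.
by field; rewrite ?k0 ?fact_neq0.
Qed.

(** Equals sqrt(2 pi m) (m / e)^m / m!, so that Stirling's formula says that it
    tends to 1.  It compares the density at m of the Gamma law of shape m + 1,
    rescaled by sqrt m, with the normal density at 0. *)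
Definition stirling m : R := Num.sqrt m%:R * pois m m%:R / npdf 0.

Lemma stirling_gt0 m : (0 < m)%N -> 0 < stirling m.
Proof.
by move=> m0; rewrite /stirling divr_gt0 ?npdf_gt0// mulr_gt0 ?sqrtr_gt0 ?pois_gt0 ?ltr0n.
Qed.

Lemma stirlingE m y : (0 < m)%N ->
  stirling m * npdf y = Num.sqrt m%:R * pois m m%:R * expR (- (y ^+ 2 / 2)).
Proof.
by move=> m0; rewrite [npdf y]npdfE /stirling; field; rewrite gt_eqF ?npdf_gt0.
Qed.

(** In the variable s the Jacobian n e^s turns the Gamma density of shape n
    into exactly a constant times exp(- n (e^s - 1 - s)). *)
Lemma has_derive_poisQ_exp n s : (0 < n)%N ->
  has_derive (fun s => poisQ n (n%:R * expR s)) s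
    (- (n%:R * pois n n%:R * expR (- (n%:R * (expR s - 1 - s))))).
Proof.
case: n => // m _.
apply: has_derive_eq.
  apply: (@has_derive_comp R (poisQ m.+1) (fun s => m.+1%:R * expR s)).
    exact: has_derive_poisQ.
  by repeat der_step.
have := poisS m (m.+1%:R * expR s); rewrite pois_scale ?ltr0n// -expRM_natl.
rewrite -!expRD.
set A := pois m.+1 _; set B := pois m _.
rewrite (_ : - (m.+1%:R * (expR s - 1 - s)) = m.+1%:R * s + (m.+1%:R - m.+1%:R * expR s)); last by ring.
by set E := expR (_ + _); rewrite /=; lra.
Qed.

Lemma sqrt_natK n : Num.sqrt (n%:R : R) * Num.sqrt n%:R = n%:R.
Proof. by rewrite -expr2 sqr_sqrtr. Qed.

Lemma stirling_sqrtE n y : (0 < n)%N ->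
  Num.sqrt n%:R * (stirling n * npdf (Num.sqrt n%:R * y)) =
  n%:R * pois n n%:R * expR (- (n%:R * y ^+ 2 / 2)).
Proof.
move=> n0; rewrite stirlingE // exprMn sqr_sqrtr ?ler0n//.
by rewrite !mulrA sqrt_natK.
Qed.

(** The difference of the two sides is monotone because
    n (e^s - 1 - s) >= n s ^ 2 / 2 - 2 / n in this range; the term
    2 / n pays for the slightly negative s that occur when L is just below n. *)
Lemma poisQ_le_ntail n s : (0 < n)%N -> - (2 / n%:R) <= s ->
  poisQ n (n%:R * expR s) <= stirling n * expR (2 / n%:R) * ntail (Num.sqrt n%:R * s).
Proof.
move=> n0 sn; rewrite -subr_ge0.
have n0' : 0 < n%:R :> R by rewrite ltr0n.
pose K : R := expR (2 / n%:R).
pose f s := stirling n * K * ntail (Num.sqrt n%:R * s) - poisQ n (n%:R * expR s).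
pose df s := n%:R * pois n n%:R * (expR (- (n%:R * (expR s - 1 - s))) -
  expR (2 / n%:R - n%:R * s ^+ 2 / 2)).
apply: (@derive_le0_ge0 _ f df s) => [y ys|y ys|e e0].
- rewrite /f; apply: has_derive_eq.
    apply: has_deriveD; last by apply: has_deriveN; exact: has_derive_poisQ_exp.
    apply: has_deriveM; first exact: has_derive_cst.
    apply: (@has_derive_comp _ ntail (fun y => Num.sqrt n%:R * y)); first exact: has_derive_ntail.
    by repeat der_step.
  have -> : df y = n%:R * pois n n%:R * expR (- (n%:R * (expR y - 1 - y))) -
      K * (n%:R * pois n n%:R * expR (- (n%:R * y ^+ 2 / 2))).
    by rewrite /df expRD -/K; ring.
  by rewrite -stirling_sqrtE//; ring.
- rewrite /df; apply: mulr_ge0_le0; first by rewrite mulr_ge0// ltW// pois_gt0.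
  rewrite subr_le0 ler_expR.
  have [y0|y0] := leP 0 y.
    by have := expR_ge_quad y y0; have : 0 < 2 / n%:R :> R; [rewrite divr_gt0|nra].
  have : n%:R * y ^+ 2 <= 4 / n%:R.
    have n1 : n%:R * n%:R^-1 = 1 :> R by rewrite divff// gt_eqF.
    have : - y <= 2 / n%:R by rewrite lerNl (le_trans sn).
    have i0 : 0 < n%:R^-1 :> R by rewrite invr_gt0.
    set i : R := n%:R^-1 in n1 i0 *; set N : R := n%:R in n0' n1 *.
    move=> yi; have : y ^+ 2 <= (2 * i) ^+ 2 by nra.
    by nra.
  have := expR_ge1Dx y.
  have -> : 4 / n%:R = 2 * (2 / n%:R) :> R by ring.
  by nra.
- exists (ln (n%:R / e)) => z Mz.
  have : expR z >= n%:R / e by rewrite -[leLHS]lnK ?ler_expR// posrE divr_gt0.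
  rewrite ler_pdivrMr// => Mz'.
  have : poisQ n (n%:R * expR z) <= e.
    apply: le_trans (poisQ_small _ _ _) _; first by rewrite mulr_gt0 ?expR_gt0.
    rewrite -mulf_div divff ?gt_eqF// mul1r ler_pdivrMr ?expR_gt0//.
    by rewrite mulrC.
  rewrite /f; have : 0 <= stirling n * K * ntail (Num.sqrt n%:R * z).
    have s0 := ltW (stirling_gt0 n n0).
    by rewrite mulr_ge0 ?ntail_ge0// mulr_ge0 ?expR_ge0.
  by lra.
Qed.

(** Now e^s - 1 - s <= s ^ 2 / 2, since s <= 0. *)
Lemma poisB_ge_ntail n s : (0 < n)%N -> s <= 0 ->
  stirling n * ntail (- (Num.sqrt n%:R * s)) <= poisB n (n%:R * expR s).
Proof.
move=> n0 s0.
suff H u : 0 <= u -> stirling n * ntail (Num.sqrt n%:R * u) <= poisB n (n%:R * expR (- u)).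
  by have := H (- s); rewrite opprK mulrN oppr_ge0; exact.
move=> u0; rewrite -subr_ge0.
have n0' : 0 < n%:R :> R by rewrite ltr0n.
pose f s := poisB n (n%:R * expR (- s)) - stirling n * ntail (Num.sqrt n%:R * s).
pose df s := n%:R * pois n n%:R * (expR (- (n%:R * s ^+ 2 / 2)) -
  expR (- (n%:R * (expR (- s) - 1 - - s)))).
apply: (@derive_le0_ge0 _ f df u) => [y yu|y yu|e e0].
- rewrite /f /poisB; apply: has_derive_eq.
    apply: has_deriveD; [apply: has_deriveD; first exact: has_derive_cst|].
      apply: has_deriveN; apply: (@has_derive_comp R (fun s => poisQ n (n%:R * expR s)) (fun s => - s)).
        exact: has_derive_poisQ_exp.
      by repeat der_step.
    apply: has_deriveN; apply: has_deriveM; first exact: has_derive_cst.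
    apply: (@has_derive_comp _ ntail (fun y => Num.sqrt n%:R * y)); first exact: has_derive_ntail.
    by repeat der_step.
  have -> : df y = n%:R * pois n n%:R * expR (- (n%:R * y ^+ 2 / 2)) -
      n%:R * pois n n%:R * expR (- (n%:R * (expR (- y) - 1 - - y))).
    by rewrite /df; ring.
  by rewrite -stirling_sqrtE//; ring.
- rewrite /df; apply: mulr_ge0_le0; first by rewrite mulr_ge0// ltW// pois_gt0.
  rewrite subr_le0 ler_expR lerN2.
  have y0 : - y <= 0 by rewrite oppr_le0 (le_trans u0).
  by have := expR_le_quad (- y) y0; rewrite sqrrN; nra.
- have e1 : 0 < e / stirling n by rewrite divr_gt0 ?stirling_gt0.
  have [M HM] := ntail_small _ e1.
  exists (Num.max 0 (M / Num.sqrt n%:R)) => z; rewrite ge_max => /andP[z0 Mz].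
  have sn0 : 0 < Num.sqrt n%:R :> R by rewrite sqrtr_gt0.
  have le : stirling n * ntail (Num.sqrt n%:R * z) <= e.
    rewrite mulrC -ler_pdivlMr ?stirling_gt0//; apply: HM.
    by rewrite mulrC -ler_pdivrMr.
  rewrite /f; have := poisB_ge0 n (n%:R * expR (- z)).
  rewrite mulr_ge0 ?expR_ge0// => /(_ isT).
  by lra.
Qed.

(** Around the mode m of the Gamma density of shape m + 1, with h = y / sqrt m,
    the density is exactly a constant times exp(- m (h - ln (1 + h))). *)
Lemma has_derive_poisQ_lin m y : (0 < m)%N ->
  has_derive (fun y => poisQ m.+1 (m%:R + Num.sqrt m%:R * y)) y
    (- (Num.sqrt m%:R * pois m m%:R *
       ((1 + y / Num.sqrt m%:R) * expR (- (y / Num.sqrt m%:R))) ^+ m)).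
Proof.
move=> m0; have m0' : 0 < m%:R :> R by rewrite ltr0n.
have s0 : Num.sqrt m%:R != 0 :> R by rewrite gt_eqF// sqrtr_gt0.
apply: has_derive_eq.
  apply: (@has_derive_comp R (poisQ m.+1) (fun s => m%:R + Num.sqrt m%:R * s)).
    exact: has_derive_poisQ.
  by repeat der_step.
have -> : m%:R + Num.sqrt m%:R * y = m%:R * (1 + y / Num.sqrt m%:R).
  by rewrite mulrDr mulr1 mulrCA -[X in y * (X / _)](sqrt_natK m) mulfK// [y * _]mulrC.
rewrite pois_scale// exprMn -expRM_natl.
have -> : m%:R - m%:R * (1 + y / Num.sqrt m%:R) = m%:R * - (y / Num.sqrt m%:R) :> R by ring.
by rewrite /=; ring.
Qed.

Lemma expR_sqr_pow m y : (0 < m)%N ->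
  expR (- (y ^+ 2 / 2)) = expR (- ((y / Num.sqrt m%:R) ^+ 2 / 2)) ^+ m.
Proof.
move=> m0; have m0' : 0 < m%:R :> R by rewrite ltr0n.
rewrite -expRM_natl; congr expR.
rewrite expr_div_n sqr_sqrtr ?ler0n//.
by field; rewrite gt_eqF.
Qed.

(** Here h - ln (1 + h) <= h ^ 2 / 2, since h >= 0. *)
Lemma poisQ_ge_ntail m y : (0 < m)%N -> 0 <= y ->
  stirling m * ntail y <= poisQ m.+1 (m%:R + Num.sqrt m%:R * y).
Proof.
move=> m0 y0; rewrite -subr_ge0.
have m0' : 0 < m%:R :> R by rewrite ltr0n.
have s0 : 0 < Num.sqrt m%:R :> R by rewrite sqrtr_gt0.
pose f s := poisQ m.+1 (m%:R + Num.sqrt m%:R * s) - stirling m * ntail s.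
pose df s := Num.sqrt m%:R * pois m m%:R * (expR (- (s ^+ 2 / 2)) -
  ((1 + s / Num.sqrt m%:R) * expR (- (s / Num.sqrt m%:R))) ^+ m).
apply: (@derive_le0_ge0 _ f df y) => [z yz|z yz|e e0].
- rewrite /f; apply: has_derive_eq.
    apply: has_deriveD; first exact: has_derive_poisQ_lin.
    apply: has_deriveN; apply: has_deriveM; first exact: has_derive_cst.
    exact: has_derive_ntail.
  have -> : df z = Num.sqrt m%:R * pois m m%:R * expR (- (z ^+ 2 / 2)) -
      Num.sqrt m%:R * pois m m%:R *
      ((1 + z / Num.sqrt m%:R) * expR (- (z / Num.sqrt m%:R))) ^+ m.
    by rewrite /df; ring.
  by rewrite -stirlingE//; ring.
- rewrite /df; apply: mulr_ge0_le0; first by rewrite mulr_ge0// ltW// pois_gt0.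
  have z0 := le_trans y0 yz.
  rewrite subr_le0 (expR_sqr_pow m)// lerXn2r ?nnegrE ?expR_ge0//.
    by rewrite mulr_ge0 ?expR_ge0// addr_ge0// divr_ge0// ltW.
  by apply: onePexp_ge; rewrite divr_ge0// ltW.
- have e1 : 0 < e / stirling m by rewrite divr_gt0 ?stirling_gt0.
  have [M HM] := ntail_small _ e1.
  exists (Num.max 0 M) => z; rewrite ge_max => /andP[z0 Mz].
  have := HM z Mz; rewrite ler_pdivlMr ?stirling_gt0// mulrC => le.
  have : 0 <= poisQ m.+1 (m%:R + Num.sqrt m%:R * z).
    by apply: poisQ_ge0; rewrite addr_ge0 ?mulr_ge0 ?(ltW s0) ?ler0n.
  rewrite /f.
  by lra.
Qed.

(** Here h - ln (1 + h) >= h ^ 2 / 2 for h <= 0; for 0 <= h <= 1 / m the exponent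
    m h ^ 2 / 2 is at most 1 / (2 m), which the exponential factor absorbs.  No
    limit is involved, since the left side vanishes at y = - sqrt m, where
    L = 0. *)
Lemma poisB_le_ntail m y : (0 < m)%N -> - Num.sqrt m%:R <= y ->
  y <= (Num.sqrt m%:R)^-1 ->
  poisB m.+1 (m%:R + Num.sqrt m%:R * y) <=
    stirling m * expR ((2 * m%:R)^-1) * ntail (- y).
Proof.
move=> m0 y0 y1; rewrite -subr_ge0.
have m0' : 0 < m%:R :> R by rewrite ltr0n.
have s0 : 0 < Num.sqrt m%:R :> R by rewrite sqrtr_gt0.
pose K : R := expR ((2 * m%:R)^-1).
pose f s := stirling m * K * ntail (- s) - poisB m.+1 (m%:R + Num.sqrt m%:R * s).
pose df s := Num.sqrt m%:R * pois m m%:R * (expR ((2 * m%:R)^-1 - (s ^+ 2 / 2)) -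
  ((1 + s / Num.sqrt m%:R) * expR (- (s / Num.sqrt m%:R))) ^+ m).
have f0 : 0 <= f (- Num.sqrt m%:R).
  rewrite /f mulrN sqrt_natK subrr /poisB poisQ0 subrr subr0.
  have st0 := ltW (stirling_gt0 m m0).
  by rewrite mulr_ge0 ?ntail_ge0// mulr_ge0 ?expR_ge0.
suff H : f (- Num.sqrt m%:R) <= f y by exact: le_trans f0 H.
apply: (@derive_ge0_ndecr _ f df (- Num.sqrt m%:R) y y0) => z /andP[z0 zy].
- rewrite /f /poisB; apply: has_derive_eq.
    apply: has_deriveD.
      apply: has_deriveM; first exact: has_derive_cst.
      by apply: (@has_derive_comp _ ntail (fun y => - y)); [exact: has_derive_ntail|repeat der_step].
    apply: has_deriveN; apply: has_deriveD; first exact: has_derive_cst.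
    by apply: has_deriveN; exact: has_derive_poisQ_lin.
  have -> : df z = K * (Num.sqrt m%:R * pois m m%:R * expR (- (z ^+ 2 / 2))) -
      Num.sqrt m%:R * pois m m%:R *
      ((1 + z / Num.sqrt m%:R) * expR (- (z / Num.sqrt m%:R))) ^+ m.
    by rewrite /df expRD -/K; ring.
  by rewrite -stirlingE// npdfN; ring.
- rewrite /df; apply: mulr_ge0; first by rewrite mulr_ge0// ltW// pois_gt0.
  have h0 : 0 <= 1 + z / Num.sqrt m%:R.
    rewrite -lerBlDl sub0r ler_pdivlMr// mulN1r //.
  have g0 : 0 <= (1 + z / Num.sqrt m%:R) * expR (- (z / Num.sqrt m%:R)).
    by rewrite mulr_ge0 ?expR_ge0.
  rewrite subr_ge0; have [zn|zp] := leP z 0.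
    apply: (@le_trans _ _ (expR (- (z ^+ 2 / 2)))); last first.
      by rewrite ler_expR lerDr invr_ge0 mulr_ge0// ltW.
    rewrite (expR_sqr_pow m)// lerXn2r ?nnegrE ?expR_ge0//.
    by apply: onePexp_le; rewrite mulr_le0_ge0// invr_ge0 ltW.
  apply: (@le_trans _ _ 1); first by rewrite exprn_ile1// onePexp_le1.
  rewrite -[leLHS]expR0 ler_expR subr_ge0 invfM mulrC ler_pM2l ?invr_gt0//.
  have := le_trans zy y1 => zi.
  have : z ^+ 2 <= (Num.sqrt m%:R)^-1 ^+ 2 by rewrite lerXn2r ?nnegrE ?invr_ge0 ?(ltW zp) ?(ltW s0).
  by rewrite exprVn sqr_sqrtr.
Qed.

End Poisson.

(** * Stirling's formula and hazard rates *)

Section Stirling.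
Context {R : realType}.
Implicit Types (L c : R) (m n : nat).

Lemma pois_diag m : pois m.+1 m.+1%:R = pois m m.+1%:R :> R.
Proof.
have m0 : m.+1%:R != 0 :> R by rewrite pnatr_eq0.
by apply: (mulIf m0); rewrite poisS mulrC.
Qed.

Lemma pois_succ_scale m : (0 < m)%N ->
  pois m m.+1%:R =
  pois m m%:R * ((1 + m%:R^-1) * expR (- m%:R^-1)) ^+ m :> R.
Proof.
move=> m0; have m0' : 0 < m%:R :> R by rewrite ltr0n.
have -> : m.+1%:R = m%:R * (1 + m%:R^-1) :> R.
  by rewrite -natr1; field; rewrite gt_eqF.
rewrite pois_scale// exprMn -expRM_natl.
by congr (_ * (_ * expR _)); field; rewrite gt_eqF.
Qed.

Lemma stirling_succ_le m : (0 < m)%N -> stirling m.+1 <= stirling m * expR (2 * m%:R)^-1 :> R.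
Proof.
move=> m0; have m0' : 0 < m%:R :> R by rewrite ltr0n.
have i0 : 0 <= m%:R^-1 :> R by rewrite invr_ge0 ltW.
rewrite /stirling [leRHS]mulrAC ler_pM2r ?invr_gt0 ?npdf_gt0// [leRHS]mulrAC.
apply: ler_pM; rewrite ?sqrtr_ge0 ?pois_ge0//.
  rewrite -[leLHS]ger0_norm ?sqrtr_ge0// -[leRHS]ger0_norm; last first.
    by rewrite mulr_ge0 ?sqrtr_ge0 ?expR_ge0.
  rewrite -ler_sqr ?nnegrE// !real_normK ?num_real// exprMn !sqr_sqrtr//.
  rewrite -expRM_natl (_ : 2%:R * (2 * m%:R)^-1 = m%:R^-1); last first.
    by field; rewrite gt_eqF.
  have -> : m.+1%:R = m%:R * (1 + m%:R^-1) :> R.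
    by rewrite -natr1; field; rewrite gt_eqF.
  by rewrite ler_pM2l// expR_ge1Dx.
rewrite pois_diag pois_succ_scale// ler_piMr ?pois_ge0//.
by rewrite exprn_ile1 ?onePexp_le1// mulr_ge0 ?expR_ge0// addr_ge0.
Qed.

Lemma stirling_succ_ge m : (0 < m)%N -> stirling m * expR (- (2 * m%:R)^-1) <= stirling m.+1 :> R.
Proof.
move=> m0; have m0' : 0 < m%:R :> R by rewrite ltr0n.
have i0 : 0 <= m%:R^-1 :> R by rewrite invr_ge0 ltW.
rewrite /stirling [leLHS]mulrAC ler_pM2r ?invr_gt0 ?npdf_gt0// -mulrA.
apply: ler_pM; rewrite ?sqrtr_ge0 ?mulr_ge0 ?expR_ge0 ?pois_ge0//.
  by rewrite ler_wsqrtr// ler_nat.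
rewrite pois_diag pois_succ_scale// ler_pM2l ?pois_gt0//.
have -> : - (2 * m%:R)^-1 = m%:R * - (m%:R^-1 ^+ 2 / 2) :> R.
  by field; rewrite gt_eqF.
rewrite expRM_natl lerXn2r ?nnegrE ?expR_ge0 ?mulr_ge0 ?expR_ge0 ?addr_ge0//.
exact: onePexp_ge.
Qed.

Lemma pois_le_center m L : (0 < m)%N -> 0 <= L -> pois m L <= pois m m%:R.
Proof.
move=> m0 L0; have m0' : 0 < m%:R :> R by rewrite ltr0n.
have -> : L = m%:R * (1 + (L / m%:R - 1)) by field; rewrite gt_eqF.
have h0 : 0 <= 1 + (L / m%:R - 1) by rewrite addrC subrK divr_ge0.
move: (L / m%:R - 1) h0 => h h0.
rewrite pois_scale// ler_piMr ?pois_ge0//.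
have -> : m%:R - m%:R * (1 + h) = m%:R * - h by ring.
by rewrite expRM_natl -exprMn exprn_ile1 ?onePexp_le1// mulr_ge0 ?expR_ge0.
Qed.

(** Of two comparisons for complementary tails, one is centred at m and the other
    at m + 1; between the centres the density is at most its maximum. *)
Lemma poisQ_gap m : (0 < m)%N ->
  poisQ m.+1 m%:R - poisQ m.+1 m.+1%:R <= stirling m / (2 * Num.sqrt m%:R) :> R.
Proof.
move=> m0; have m0' : 0 < m%:R :> R by rewrite ltr0n.
have s0 : 0 < Num.sqrt m%:R :> R by rewrite sqrtr_gt0.
apply: (@le_trans _ _ (pois m m%:R)); last first.
  have -> : pois m m%:R = stirling m * npdf 0 / Num.sqrt m%:R :> R.
    by rewrite /stirling; field; rewrite !gt_eqF ?npdf_gt0.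
  rewrite invfM mulrA ler_pM2r ?invr_gt0// ler_pM2l ?stirling_gt0//.
  exact: npdf0_le.
have : poisQ m.+1 m%:R + pois m m%:R * m%:R <=
       poisQ m.+1 m.+1%:R + pois m m%:R * m.+1%:R :> R.
  apply: (@derive_ge0_ndecr R (fun L => poisQ m.+1 L + pois m m%:R * L)
    (fun L => - pois m L + pois m m%:R)) => [|L _|L /andP[Lm _]].
  - by rewrite ler_nat.
  - by der; [exact: has_derive_poisQ|rewrite /=; ring].
  - by rewrite addrC subr_ge0 pois_le_center// (le_trans _ Lm).
by rewrite -[in pois m m%:R * m.+1%:R]natr1 mulrDr mulr1; lra.
Qed.

(** The lower comparisons at their centres bound half of each constant by a
    tail, and the tails add up to 1 up to [poisQ_gap]. *)
Lemma stirling_sum_le m : (0 < m)%N ->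
  stirling m + stirling m.+1 <= 2 + stirling m / Num.sqrt m%:R :> R.
Proof.
move=> m0; have m0' : 0 < m%:R :> R by rewrite ltr0n.
have s0 : 0 < Num.sqrt m%:R :> R by rewrite sqrtr_gt0.
have := @poisQ_ge_ntail R m 0 m0 (lexx _); rewrite mulr0 addr0 ntail0.
have := @poisB_ge_ntail R m.+1 0 isT (lexx _); rewrite mulr0 oppr0 expR0 mulr1 ntail0.
have := poisQ_gap m m0; rewrite invfM mulrA mulrAC /poisB.
by lra.
Qed.

(** The same with the upper comparisons. *)
Lemma stirling_sum_ge m : (0 < m)%N ->
  2 <= expR (2 / m%:R) * (stirling m + stirling m.+1) + stirling m / Num.sqrt m%:R :> R.
Proof.
move=> m0; have m0' : 0 < m%:R :> R by rewrite ltr0n.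
have s0 : 0 < Num.sqrt m%:R :> R by rewrite sqrtr_gt0.
have i0 : 0 < m%:R^-1 :> R by rewrite invr_gt0.
have := @poisQ_le_ntail R m.+1 0 isT.
rewrite mulr0 expR0 mulr1 ntail0 oppr_le0 divr_ge0// => /(_ isT) A.
have := @poisB_le_ntail R m 0 m0.
rewrite mulr0 addr0 oppr0 ntail0 oppr_le0 sqrtr_ge0 invr_ge0 sqrtr_ge0.
move=> /(_ isT isT) B.
have := poisQ_gap m m0; rewrite invfM mulrA mulrAC => C.
have e1 : expR (2 / m.+1%:R) <= expR (2 / m%:R) :> R.
  by rewrite ler_expR ler_pM2l// lef_pV2 ?posrE ?ltr0n// ler_nat.
have e2 : expR (2 * m%:R)^-1 <= expR (2 / m%:R) :> R.
  by rewrite ler_expR invfM ler_pM2r//; lra.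
have A' := ler_wpM2l (ltW (stirling_gt0 m.+1 isT)) e1.
have B' := ler_wpM2l (ltW (stirling_gt0 m m0)) e2.
move: B; rewrite /poisB; nra.
Qed.

Lemma stirling_le m : (4 <= m)%N -> stirling m <= expR (2 / Num.sqrt m%:R) :> R.
Proof.
move=> m4; have m0 : (0 < m)%N by apply: leq_trans m4.
have m0' : 0 < m%:R :> R by rewrite ltr0n.
have s0 : 0 < Num.sqrt m%:R :> R by rewrite sqrtr_gt0.
have s2 : 2 <= Num.sqrt m%:R :> R.
  rewrite -ler_sqr ?nnegrE ?sqrtr_ge0// sqr_sqrtr// -natrX ler_nat//.
set z : R := (Num.sqrt m%:R)^-1.
have zs : z * Num.sqrt m%:R = 1 by rewrite mulVf// gt_eqF.
have z0 : 0 < z by rewrite invr_gt0.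
have z2 : z <= 2^-1 by rewrite lef_pV2 ?posrE.
have mz : (2 * m%:R)^-1 = z ^+ 2 / 2 by rewrite invfM exprVn sqr_sqrtr// mulrC.
have := stirling_sum_le m m0; rewrite -/z.
have := stirling_succ_ge m m0; rewrite mz.
have := expR_ge1Dx (- (z ^+ 2 / 2)).
have := expR_ge1Dx (2 * z).
have := @stirling_gt0 R m m0.
set a := stirling m; set b := stirling m.+1; set E := expR (- _); set F := expR _.
move=> a0 HF HE Hab Hs.
have h1 : a * (1 - z) <= 1 by nra.
have : a * (1 - z) <= (1 + 2 * z) * (1 - z) by nra.
by rewrite ler_pM2r; [lra|lra].
Qed.

Lemma stirling_ge m : (100 <= m)%N -> expR (- (2 / Num.sqrt m%:R)) <= stirling m :> R.
Proof.
move=> m4; have m0 : (0 < m)%N by apply: leq_trans m4.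
have m0' : 0 < m%:R :> R by rewrite ltr0n.
have s0 : 0 < Num.sqrt m%:R :> R by rewrite sqrtr_gt0.
have s2 : 10 <= Num.sqrt m%:R :> R.
  rewrite -ler_sqr ?nnegrE ?sqrtr_ge0// sqr_sqrtr// -natrX ler_nat//.
set z : R := (Num.sqrt m%:R)^-1.
have zs : z * Num.sqrt m%:R = 1 by rewrite mulVf// gt_eqF.
have z0 : 0 < z by rewrite invr_gt0.
have z2 : z <= 10^-1 by rewrite lef_pV2 ?posrE.
have mz : m%:R^-1 = z ^+ 2 by rewrite exprVn sqr_sqrtr.
have H := stirling_sum_ge m m0; rewrite mz -/z in H.
have Hb := stirling_succ_le m m0; rewrite invfM mz in Hb.
have E1 : expR (2 * z ^+ 2) <= expR (z / 2) by rewrite ler_expR; nra.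
have E2 : expR (2^-1 * z ^+ 2) <= expR (z / 2) by rewrite ler_expR; nra.
have E3 := expR_ge1Dx (z / 2).
rewrite expRN -[leLHS]mul1r ler_pdivrMr ?expR_gt0//.
have -> : 2 * z = z / 2 + z / 2 + z / 2 + z / 2 by field.
rewrite !expRD.
have := @stirling_gt0 R m m0.
move: E1 E2 E3 H Hb.
set a := stirling m; set b := stirling m.+1.
set e := expR (z / 2); set e1 := expR _; set e2 := expR _.
move=> E1 E2 E3 H Hb a0.
have e0 : 1 <= e by lra.
have e10 : 0 < e1 by exact: expR_gt0.
have b' : b <= a * e by apply: le_trans Hb _; rewrite ler_pM2l.
have : e1 * (a + b) <= e * (a + a * e).
  by apply: ler_pM => //; [exact: ltW|rewrite addr_ge0 ?ltW ?stirling_gt0|lra].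
have za : a * z <= a * (2 * (e - 1)) by rewrite ler_pM2l//; lra.
move=> H2; have H3 : 2 <= a * (e + e * e + 2 * (e - 1)) by nra.
have : e + e * e + 2 * (e - 1) <= 2 * (e * e * e * e).
  have e2' : 1 <= e * e by nra.
  have : e * e <= e * e * e * e by nra.
  have : 3 * e - 2 <= e * e * e * e by nra.
  by lra.
by nra.
Qed.

(** The hazard rate of the Gamma law: Q - L pois / (L - m + c) tends to 0 at
    infinity and is nonincreasing as soon as m <= c ^ 2.  With c = sqrt m the
    bound has the right order at all distances from the centre, whereas the
    normal comparison would lose a factor exp(x ^ 3 / sqrt n). *)
Lemma poisQ_hazard m c L : 0 < c -> m%:R <= c ^+ 2 -> m%:R <= L ->
  L * pois m L <= poisQ m.+1 L * (L - m%:R + c).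
Proof.
move=> c0 mc mL.
pose f y := poisQ m.+1 y - m.+1%:R * pois m.+1 y / (y - m%:R + c).
pose df y := - pois m y * (((y - m%:R) * c + c ^+ 2 + c - m%:R) / (y - m%:R + c) ^+ 2).
suff : 0 <= f L.
  rewrite /f subr_ge0 [_ * pois _ _]mulrC poisS ler_pdivrMr//.
  by rewrite ltr_wpDl ?subr_ge0.
have n0' : (0:R) <= m%:R by [].
apply: (@derive_le0_ge0 _ f df L) => [y yL|y yL|e e0].
- have d0 : y - m%:R + c != 0 by rewrite gt_eqF//; lra.
  rewrite /f; der => //; [exact: has_derive_poisQ|exact: has_derive_pois|].
  have := poisS m y; rewrite mulrC => E.
  rewrite mulrBr /= E /df -natr1.
  by field; exact: d0.
- rewrite /df mulNr oppr_le0 mulr_ge0 ?pois_ge0//; first by lra.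
  rewrite divr_ge0 ?sqr_ge0//.
  have : 0 <= (y - m%:R) * c by rewrite mulr_ge0 ?subr_ge0 ?(ltW c0)// (le_trans mL).
  by lra.
- exists (Num.max (Num.max 1 (2 * m%:R)) (2 * m.+1%:R / e)) => z.
  rewrite !ge_max => /andP[/andP[z1 z2]]; rewrite ler_pdivrMr// => z3.
  have z0 : 0 < z by lra.
  have Q0 := poisQ_ge0 m.+1 z (ltW z0).
  have d0 : 0 < z - m%:R + c by lra.
  have p0 := pois_ge0 m z (ltW z0).
  suff : m.+1%:R * pois m.+1 z / (z - m%:R + c) <= e by rewrite /f; lra.
  rewrite [_ * pois _ _]mulrC poisS ler_pdivrMr//.
  have := pois_small m z z0; rewrite ler_pdivlMr// mulrC => ps.
  have : z * pois m z <= e * (z / 2) by lra.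
  move=> h; apply: le_trans h _.
  by rewrite ler_pM2l//; lra.
Qed.

(** The reverse hazard rate, by the same argument started at L = 0. *)
Lemma poisB_hazard_rate m c L : 1 < c -> m.+1%:R <= (c - 1) ^+ 2 -> 0 <= L -> L <= m.+1%:R ->
  L * pois m L <= poisB m.+1 L * (m%:R - L + c).
Proof.
rewrite -natr1 => c0 mc L0 mL.
pose f y := poisB m.+1 y - m.+1%:R * pois m.+1 y / (m%:R - y + c).
pose df y := pois m y * (((m%:R - y + c) * (c - 1) - y) / (m%:R - y + c) ^+ 2).
have d0' : 0 < m%:R - L + c by lra.
suff : f 0 <= f L.
  rewrite {1}/f /poisB poisQ0 subrr /pois expr0n /= mulr0 !mul0r mulr0 mul0r subrr.
  by rewrite /f subr_ge0 [_ * pois _ _]mulrC poisS ler_pdivrMr.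
apply: (@derive_ge0_ndecr _ f df 0 L L0) => [y /andP[y0 yL]|y /andP[y0 yL]].
- have d0 : m%:R - y + c != 0 by rewrite gt_eqF//; lra.
  rewrite /f /poisB; der => //; [exact: has_derive_poisQ|exact: has_derive_pois|].
  have := poisS m y; rewrite mulrC => E.
  rewrite mulrBr /= E /df -natr1.
  by field; exact: d0.
- rewrite /df mulr_ge0 ?pois_ge0//.
  rewrite divr_ge0 ?sqr_ge0//.
  have : 0 <= (m%:R + 1 - y) * c by rewrite mulr_ge0; lra.
  have : m%:R + 1 <= (c - 1) * (c - 1) by rewrite -expr2.
  by nra.
Qed.
End Stirling.

(** * Cauchy products and the Poisson part of a geometric law *)

Section Conv.
Context {R : realType}.
Implicit Types (f g h : nat -> R) (a L t : R) (n : nat).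

Definition conv f g n : R := \sum_(i < n.+1) f i * g (n - i)%N.

(** Identities between Cauchy products hold coefficientwise, hence follow from
    the ring laws for polynomials that agree with the series up to degree n. *)
Let trunc n f : {poly R} := \poly_(i < n.+1) f i.

Let convE N f g n : (n <= N)%N -> conv f g n = (trunc N f * trunc N g)`_n.
Proof.
move=> nN; rewrite coefM; apply: eq_bigr => i _; rewrite !coef_poly !ltnS.
have iN : (i <= N)%N by apply: leq_trans nN; rewrite -ltnS.
by rewrite iN (leq_trans (leq_subr _ _) nN).
Qed.

Lemma convC f g : conv f g = conv g f.
Proof. by apply/funext => n; rewrite !(convE n)// mulrC. Qed.

Lemma convA f g h : conv f (conv g h) = conv (conv f g) h.
Proof.
apply/funext => n.
have L : conv (conv f g) h n = (trunc n f * trunc n g * trunc n h)`_n.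
  rewrite coefM; apply: eq_bigr => i _; rewrite (convE n) ?coef_poly ?ltnS ?leq_subr//.
  by rewrite -ltnS.
rewrite L convC -mulrA mulrC coefM; apply: eq_bigr => i _.
by rewrite (convE n) ?coef_poly ?ltnS ?leq_subr// -ltnS.
Qed.

Definition delta0 n : R := (n == 0%N)%:R.

Lemma conv_delta0 f : conv delta0 f = f.
Proof.
apply/funext => n; rewrite /conv big_ord_recl subn0 mul1r big1 ?addr0// => i _.
by rewrite mul0r.
Qed.

Lemma conv_ge0 f g : (forall n, 0 <= f n) -> (forall n, 0 <= g n) ->
  forall n, 0 <= conv f g n.
Proof. by move=> f0 g0 n; apply: sumr_ge0 => i _; rewrite mulr_ge0. Qed.

Lemma conv_scale f g t n :
  conv (fun i => f i * t ^+ i) (fun i => g i * t ^+ i) n = conv f g n * t ^+ n.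
Proof.
rewrite /conv mulr_suml; apply: eq_bigr => i _.
have /subnKC E : (i <= n)%N by rewrite -ltnS.
have -> : t ^+ n = t ^+ i * t ^+ (n - i) by rewrite -exprD E.
by ring.
Qed.

Lemma conv_exp_coeff a b : conv (exp_coeff a) (exp_coeff b) = exp_coeff (a + b).
Proof.
apply/funext => n; rewrite /conv /exp_coeff /= addrC exprDn mulr_suml.
apply: eq_bigr => i _.
have iN : (i <= n)%N by rewrite -ltnS.
have E := bin_fact iN.
have : ('C(n, i)%:R : R) * (i`!%:R * (n - i)`!%:R) = n`!%:R by rewrite -!natrM E.
rewrite -[(_ * _) *+ _]mulr_natl => <-.
have := @fact_neq0 R i; have := @fact_neq0 R (n - i).
have : ('C(n, i)%:R : R) != 0 by rewrite pnatr_eq0 -lt0n bin_gt0.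
move: ('C(n, i)%:R : R) => c c0 u0 v0.
by field; rewrite c0 u0 v0.
Qed.

Lemma exp_coeff0 : exp_coeff 0 = delta0.
Proof.
apply/funext => -[|n]; first by rewrite /exp_coeff /= /delta0 expr0 fact0 divr1.
by rewrite /exp_coeff /= expr0n /= mul0r.
Qed.

Definition geo a n : R := a ^+ n.

(** The coefficients of e^(- a z) / (1 - a z): up to normalisation, the law of
    what must be added to a Poisson variable of mean a to get a geometric
    variable of ratio a. *)
Definition excess a := conv (geo a) (exp_coeff (- a)).

Lemma excess_geo a : conv (excess a) (exp_coeff a) = geo a.
Proof. by rewrite /excess -convA conv_exp_coeff addNr exp_coeff0 convC conv_delta0. Qed.

(** Partial sums of the series of 1 / e; [excess a n] is a^n times such a sum. *)
Let d n : R := \sum_(i < n.+1) (-1) ^+ i / i`!%:R.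

Let excessE a n : excess a n = a ^+ n * d n.
Proof.
rewrite /excess convC /conv /d mulr_sumr; apply: eq_bigr => i _.
have /subnKC E : (i <= n)%N by rewrite -ltnS.
have -> : a ^+ n = a ^+ i * a ^+ (n - i) by rewrite -exprD E.
by rewrite /geo /exp_coeff /= [(- a) ^+ _]exprNn; ring.
Qed.

Let dS n : d n.+1 = d n + (-1) ^+ n.+1 / n.+1`!%:R.
Proof. by rewrite /d big_ord_recr. Qed.

Let d_ge n : (~~ odd n)%:R / n`!%:R <= d n.
Proof.
elim: n => [|n IH]; first by rewrite /d big_ord1 /= expr0.
rewrite dS -signr_odd /=; case: (odd n) IH => /= IH.
  by rewrite expr0 lerDr (le_trans _ IH)// mul0r.
rewrite expr1 mul0r mulN1r subr_ge0; apply: le_trans IH.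
rewrite mul1r lef_pV2 ?posrE ?ltr0n ?fact_gt0// ler_nat factS.
by rewrite leq_pmull.
Qed.

Let d_ge0 n : 0 <= d n.
Proof. by apply: le_trans (d_ge n); rewrite divr_ge0. Qed.

Let d_le1 n : d n <= 1.
Proof.
suff H : d n <= 1 - (odd n)%:R / n`!%:R.
  by apply: le_trans H _; rewrite gerBl divr_ge0.
elim: n => [|n IH]; first by rewrite /d big_ord1 /= expr0 mul0r subr0 divr1.
rewrite dS -signr_odd /=; case: (odd n) IH => /= IH.
  rewrite expr0 mul0r subr0.
  have : 1 / n.+1`!%:R <= 1 / n`!%:R :> R.
    rewrite !mul1r lef_pV2 ?posrE ?ltr0n ?fact_gt0// ler_nat factS.
    by rewrite leq_pmull.
  by lra.
by rewrite expr1; move: IH; rewrite mul0r; lra.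
Qed.

Lemma excess_ge0 a n : 0 <= a -> 0 <= excess a n.
Proof. by move=> a0; rewrite excessE mulr_ge0 ?exprn_ge0. Qed.

(** Multiplying a partial sum by 1 - a t turns it into a partial sum of the
    exponential series, up to a vanishing term. *)
Lemma excess_cvg a t : 0 <= a * t < 1 ->
  series (fun n => excess a n * t ^+ n) @ \oo --> expR (- (a * t)) / (1 - a * t).
Proof.
move=> /andP[at0 at1]; set u := a * t in at0 at1 *.
have u1 : 1 - u != 0 by rewrite gt_eqF// subr_gt0.
have E n : series (fun n => excess a n * t ^+ n) n.+1 =
    (series (exp_coeff (- u)) n.+1 - d n * u ^+ n.+1) / (1 - u).
  apply: (mulIf u1); rewrite mulfVK//.
  rewrite /series /=; elim: n => [|n IH].
    rewrite !big_nat1 excessE /exp_coeff /= !expr0 fact0.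
    have -> : d 0 = 1 by rewrite /d big_ord1 expr0 fact0 divr1.
    by rewrite expr1; field.
  rewrite big_nat_recr//= [X in _ = X - _]big_nat_recr//= mulrDl IH dS excessE dS.
  rewrite /exp_coeff /= [(- u) ^+ _]exprNn -/u.
  have -> : a ^+ n.+1 * (d n + (-1) ^+ n.+1 / n.+1`!%:R) * t ^+ n.+1 =
    u ^+ n.+1 * (d n + (-1) ^+ n.+1 / n.+1`!%:R) by rewrite /u exprMn; ring.
  by rewrite [u ^+ n.+2]exprS; ring.
rewrite -cvg_shiftS /=.
under eq_fun do rewrite E.
apply: cvgM; last exact: cvg_cst.
rewrite -[expR _]subr0; apply: cvgB.
  rewrite (cvg_shiftS (series (exp_coeff (- u)))).
  exact: is_cvg_series_exp_coeff.
have g0 : u ^+ n.+1 @[n --> \oo] --> 0.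
  rewrite (cvg_shiftS (fun n => u ^+ n)); apply: cvg_expr.
  by rewrite ger0_norm.
apply: (@squeeze_cvgr _ _ _ _ (fun=> 0) (fun n => u ^+ n.+1)) => //; last exact: cvg_cst.
near=> n; rewrite mulr_ge0 ?exprn_ge0//= ler_piMl ?exprn_ge0//.
Unshelve. all: by end_near. Qed.

Lemma series_conv f g n :
  series (conv f g) n = \sum_(i < n) f i * series g (n - i)%N.
Proof.
elim: n => [|n IH]; first by rewrite /series /= big_geq// big_ord0.
rewrite seriesSr IH /conv big_ord_recr /= addrA -big_split /= big_ord_recr /=.
rewrite subnn subSnn; congr (_ + _); last first.
  by rewrite /series /= big_nat1.
apply: eq_bigr => i _; rewrite subSn; last exact: ltnW.
by rewrite seriesSr mulrDr.
Qed.

Lemma series_nneg_le f M N : (forall n, 0 <= f n) -> (M <= N)%N ->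
  series f M <= series f N.
Proof.
by move=> f0 MN; apply: (nondecreasing_series (P := xpredT)) => // n _ _.
Qed.

Lemma series_nneg_le_lim f (A : R) n : (forall n, 0 <= f n) ->
  series f @ \oo --> A -> series f n <= A.
Proof.
move=> f0 fA; rewrite -(cvg_lim _ fA)//; apply: nondecreasing_cvgn_le.
  by move=> i j; exact: series_nneg_le.
by apply/cvg_ex; exists A.
Qed.

Lemma series_ge0 f n : (forall n, 0 <= f n) -> 0 <= series f n.
Proof. by move=> f0; apply: sumr_ge0. Qed.

(** The n-th partial sums satisfy S_n(f) S_n(g) <= S_2n(conv f g) <= A B. *)
Lemma cvg_series_conv f g (A B : R) :
  (forall n, 0 <= f n) -> (forall n, 0 <= g n) ->
  series f @ \oo --> A -> series g @ \oo --> B ->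
  series (conv f g) @ \oo --> A * B.
Proof.
move=> f0 g0 fA gB.
have c0 := conv_ge0 f g f0 g0.
have A0 : 0 <= A by apply: le_trans (series_ge0 f 0 f0) (series_nneg_le_lim f A 0 f0 fA).
have B0 : 0 <= B by apply: le_trans (series_ge0 g 0 g0) (series_nneg_le_lim g B 0 g0 gB).
have up n : series (conv f g) n <= A * B.
  rewrite series_conv; apply: (@le_trans _ _ (series f n * B)).
    rewrite /series /= big_mkord mulr_suml; apply: ler_sum => i _.
    by rewrite ler_wpM2l// series_nneg_le_lim.
  by rewrite ler_wpM2r// series_nneg_le_lim.
have lo n : series f n * series g n <= series (conv f g) (n + n)%N.
  rewrite series_conv big_split_ord /= -[leLHS]addr0.
  apply: lerD; last first.
    by apply: sumr_ge0 => i _; rewrite mulr_ge0// series_ge0.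
  rewrite {1}/series /= big_mkord mulr_suml; apply: ler_sum => i _.
  rewrite ler_wpM2l// series_nneg_le// -addnBA ?leq_addr//.
  exact: ltnW.
have cv : cvgn (series (conv f g)).
  apply: nondecreasing_is_cvgn; first by move=> i j; exact: series_nneg_le.
  by exists (A * B) => _ [n _ <-].
have lAB : limn (series (conv f g)) <= A * B.
  by apply: limr_le => //; apply: nearW.
suff -> : A * B = limn (series (conv f g)) by [].
apply/eqP; rewrite eq_le lAB andbT.
have AB : (series f \* series g) @ \oo --> A * B by exact: cvgM.
rewrite -(cvg_lim _ AB)//.
apply: limr_le; first by apply/cvg_ex; exists (A * B).
apply: nearW => n; apply: le_trans (lo n) _.
exact: series_nneg_le_lim.
Qed.

End Conv.

(** * Complete homogeneous symmetric polynomials *)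

Section Homogeneous.
Context {R : realType}.
Implicit Types (s : seq R) (a t : R) (n m : nat).

(** The coefficients of the product of the 1 / (1 - a z), for a in s. *)
Definition complete_hom s : nat -> R := foldr (fun a h => conv (geo a) h) delta0 s.
Definition excesses s : nat -> R := foldr (fun a h => conv (excess a) h) delta0 s.

(** A sum of geometric variables is a Poisson variable, whose mean is the sum of
    the ratios, plus an independent excess. *)
Lemma complete_hom_excesses s : complete_hom s = conv (excesses s) (exp_coeff (\sum_(a <- s) a)).
Proof.
elim: s => [|a s IH]; first by rewrite big_nil exp_coeff0 convC conv_delta0.
have -> : complete_hom (a :: s) = conv (geo a) (complete_hom s) by [].
have -> : excesses (a :: s) = conv (excess a) (excesses s) by [].
rewrite big_cons -conv_exp_coeff IH.
move: (excess a) (excess_geo a) (excesses s) (exp_coeff _) => e <- x q.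
rewrite -!convA; congr conv.
by rewrite !convA (convC (exp_coeff a) x).
Qed.

Lemma complete_homS a s m : complete_hom (a :: s) m.+1 = complete_hom s m.+1 + a * complete_hom (a :: s) m.
Proof.
rewrite /= /conv big_ord_recl subn0 /geo expr0 mul1r; congr (_ + _).
rewrite mulr_sumr; apply: eq_bigr => i _.
by rewrite lift0 exprS subSS mulrA.
Qed.

(** The coefficients of H_(a :: s) = H_s + a z H_(a :: s), summed: the recursion
    on the smallest digit obeyed by the measure of the event q_n > N. *)
Lemma series_complete_homS a s n :
  series (complete_hom (a :: s)) n.+1 = series (complete_hom s) n.+1 + a * series (complete_hom (a :: s)) n.
Proof.
elim: n => [|n IH].
  rewrite /series /= !big_nat1 big_geq// mulr0 addr0.
  by rewrite /conv big_ord1 /geo expr0 mul1r.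
rewrite [LHS]seriesSr complete_homS [series (complete_hom s) n.+2]seriesSr.
rewrite [series (complete_hom (a :: s)) n.+1 in RHS]seriesSr IH.
by ring.
Qed.

Lemma excesses_ge0 s n : (forall a, a \in s -> 0 <= a) -> 0 <= excesses s n.
Proof.
elim: s n => [|a s IH] n s0 /=; first by rewrite /delta0.
apply: conv_ge0 => i.
  by apply: excess_ge0; apply: s0; rewrite inE eqxx.
by apply: IH => b bs; apply: s0; rewrite inE bs orbT.
Qed.

Lemma excesses_cvg s t : 0 <= t -> (forall a, a \in s -> 0 <= a /\ a * t < 1) ->
  series (fun n => excesses s n * t ^+ n) @ \oo -->
    \prod_(a <- s) (expR (- (a * t)) / (1 - a * t)).
Proof.
move=> t0; elim: s => [|a s IH] s0 /=.
  rewrite big_nil; have -> : (fun n => delta0 n * t ^+ n) = delta0.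
    by apply/funext => -[|n]; rewrite /delta0 ?expr0 ?mulr1 ?mul0r.
  rewrite -cvg_shiftS /=; apply: (@cvg_trans _ ((fun=> (1:R)) @ \oo)); last exact: cvg_cst.
  apply: near_eq_cvg; apply: nearW => n.
  by rewrite /series /= big_nat_recl// big1 ?addr0.
have [a0 at1] : 0 <= a /\ a * t < 1 by apply: s0; rewrite inE eqxx.
have s0' b : b \in s -> 0 <= b /\ b * t < 1 by move=> bs; apply: s0; rewrite inE bs orbT.
rewrite big_cons.
have -> : (fun n => conv (excess a) (excesses s) n * t ^+ n) =
   conv (fun i => excess a i * t ^+ i) (fun i => excesses s i * t ^+ i).
  by apply/funext => n; rewrite conv_scale.
apply: cvg_series_conv; last exact: IH.
- by move=> n; rewrite mulr_ge0 ?exprn_ge0 ?excess_ge0.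
- by move=> n; rewrite mulr_ge0 ?exprn_ge0 ?excesses_ge0// => b /s0'[].
- by apply: excess_cvg; rewrite mulr_ge0.
Qed.

End Homogeneous.

(** * Shifting the threshold of a Poisson tail *)

Section PoissonConcave.
Context {R : realType}.
Implicit Types (L : R) (m n j k : nat).

Lemma poisQ_series k L : poisQ k L = expR (- L) * series (exp_coeff L) k.
Proof.
rewrite /poisQ /series /= big_mkord mulr_sumr; apply: eq_bigr => i _.
by rewrite /pois /exp_coeff /= mulrA.
Qed.

Lemma poisB_succ k L : poisB k L = poisB k.+1 L + pois k L.
Proof. by rewrite /poisB /poisQ big_ord_recr /=; ring. Qed.

(** The difference of the two sides vanishes at L = 0 and its derivative is
    [poisB k.+1 L] >= 0. *)
Lemma poisB_mills k L : 0 <= L -> (k.+1%:R - L) * poisB k.+1 L <= L * pois k L.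
Proof.
move=> L0; rewrite -subr_ge0.
pose f (y : R) := y * pois k y - (k.+1%:R - y) * poisB k.+1 y.
suff : f 0 <= f L by rewrite {1}/f mul0r /poisB poisQ0 subrr mulr0 subrr.
have fE : f = fun y : R => k.+1%:R * pois k.+1 y - (k.+1%:R - y) * (1 - poisQ k.+1 y).
  by apply/funext => y; rewrite /f -poisS mulrC.
apply: (@derive_ge0_ndecr R f (fun y => poisB k.+1 y) 0 L L0) => y /andP[y0 _].
- rewrite fE; der; [exact: has_derive_pois|exact: has_derive_poisQ|].
  by have := poisS k y; rewrite /poisB /=; lra.
- exact: poisB_ge0.
Qed.

Lemma poisB_gt0 k L : 0 < L -> 0 < poisB k L.
Proof.
move=> L0; rewrite poisB_succ; apply: ltr_wpDl; last exact: pois_gt0.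
exact/poisB_ge0/ltW.
Qed.

Lemma poisB_logconcave k L : 0 < L ->
  pois k L * poisB k.+2 L <= pois k.+1 L * poisB k.+1 L.
Proof.
move=> L0; have := poisB_mills k L (ltW L0).
have := poisS k L; have := pois_gt0 k L L0; have := poisB_gt0 k.+2 L L0.
rewrite (poisB_succ k.+1).
have k0 : 0 < k.+1%:R :> R by rewrite ltr0n.
move: (pois k L) (pois k.+1 L) (poisB k.+2 L) (k.+1%:R : R) k0 => p p1 b K K0 b0 p0 E H.
rewrite -(ler_pM2l L0) -subr_ge0.
have -> : L * (p1 * (b + p1)) - L * (p * b) = p1 * (L * p - (K - L) * (b + p1)) by rewrite [L * (p * b)]mulrA -E; ring.
rewrite mulr_ge0 ?subr_ge0//.
by rewrite -(ler_pM2r K0) mul0r E mulr_ge0 ?ltW.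
Qed.

Lemma poisB_ratio k n L : 0 < L -> (k <= n)%N ->
  pois k L * poisB n.+1 L <= pois n L * poisB k.+1 L.
Proof.
move=> L0 kn; rewrite -(subnKC kn); elim: (n - k)%N => [|j IH]; first by rewrite addn0.
rewrite addnS; have := poisB_logconcave (k + j) L L0.
have := pois_gt0 (k + j) L L0; have := poisB_gt0 (k + j).+1 L L0.
have := poisB_gt0 (k + j).+2 L L0; have := poisB_gt0 k.+1 L L0.
move: IH; move: (pois k L) (pois (k + j) L) (pois (k + j).+1 L).
move: (poisB k.+1 L) (poisB (k + j).+1 L) (poisB (k + j).+2 L).
move=> bk bj b1 pk pj p1 IH bk0 b10 bj0 pj0 H.
rewrite -(ler_pM2r bj0) -(ler_pM2r pj0).
have : pk * bj * (pj * b1) <= pj * bk * (p1 * bj).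
  apply: le_trans (_ : pj * bk * (pj * b1) <= _).
    by rewrite ler_wpM2r// ltW// mulr_gt0.
  by rewrite ler_pM2l// mulr_gt0.
by lra.
Qed.

(** Lowering the threshold by 1 multiplies the upper tail by 1 + pois k / poisB k.+1,
    a ratio that increases with k by log-concavity; so j steps from n.+1
    cost at most the j-th power of the first ratio. *)
Lemma poisB_geom n j L : 0 < L ->
  poisB (n.+1 - j) L <= (1 + pois n L / poisB n.+1 L) ^+ j * poisB n.+1 L.
Proof.
move=> L0; have bn := poisB_gt0 n.+1 L L0.
have t0 : 0 <= pois n L / poisB n.+1 L.
  by rewrite divr_ge0 ?ltW// pois_gt0.
elim: j => [|j IH]; first by rewrite subn0 expr0 mul1r.
have [jn|jn] := leqP j n; last first.
  have -> : (n.+1 - j.+1 = n.+1 - j)%N by lia.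
  apply: le_trans IH _; rewrite ler_pM2r// exprS ler_peMl//.
    by rewrite exprn_ge0// addr_ge0.
  by rewrite lerDl.
have E : (n.+1 - j = (n.+1 - j.+1).+1)%N by lia.
rewrite poisB_succ -E.
have kn : (n.+1 - j.+1 <= n)%N by lia.
have := poisB_ratio _ n L L0 kn; rewrite -E => H.
rewrite exprS -mulrA.
apply: le_trans (_ : (1 + pois n L / poisB n.+1 L) * poisB (n.+1 - j) L <= _).
  rewrite mulrDl mul1r lerD2l mulrAC ler_pdivlMr//.
by rewrite ler_wpM2l// addr_ge0.
Qed.

Lemma pois_mono m k L : m%:R <= L -> (k <= m)%N -> pois k L <= pois m L.
Proof.
move=> mL km; have L0 : 0 <= L by apply: le_trans mL.
elim: m mL km => [|m IH] mL; first by rewrite leqn0 => /eqP ->.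
rewrite leq_eqVlt => /orP[/eqP -> //|]; rewrite ltnS => km.
have mL' : m%:R <= L by apply: le_trans mL; rewrite ler_nat.
apply: le_trans (IH mL' km) _.
have m0 : 0 < m.+1%:R :> R by rewrite ltr0n.
by rewrite -(ler_pM2r m0) poisS mulrC ler_wpM2r ?pois_ge0.
Qed.

(** For m <= L the point masses below m + 1 are largest at m. *)
Lemma poisQ_sub_lipschitz m j L : m%:R <= L ->
  poisQ m.+1 L - j%:R * pois m L <= poisQ (m.+1 - j) L.
Proof.
move=> mL; have L0 : 0 <= L by apply: le_trans mL.
elim: j => [|j IH]; first by rewrite mul0r subr0 subn0.
have [jn|jn] := leqP j m; last first.
  have -> : (m.+1 - j.+1 = m.+1 - j)%N by lia.
  apply: le_trans IH; rewrite -natr1 mulrDl.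
  by have := pois_ge0 m L L0; lra.
have E : (m.+1 - j = (m.+1 - j.+1).+1)%N by lia.
move: IH; rewrite E /poisQ [in X in _ <= X -> _]big_ord_recr /= -!/(poisQ _ _) -natr1 mulrDl.
have kn : (m.+1 - j.+1 <= m)%N by lia.
have := pois_mono m _ L mL kn.
by lra.
Qed.

End PoissonConcave.

(** * Adding an independent excess to a Poisson variable *)

Section Mixture.
Context {R : realType} (p : nat -> R).
Hypothesis p_ge0 : forall j, 0 <= p j.
Hypothesis p_sum : series p @ \oo --> (1 : R).
Hypothesis p_exp : forall t : R, 0 <= t <= 2^-1 -> forall M,
  \sum_(j < M) p j * (1 + t) ^+ j <= expR (2 * t).

(** P(Poi(L) + X < n), where X has law p. *)
Let mix n L : R := \sum_(j < n) p j * poisQ (n - j) L.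

Let mixE n M L : (n <= M)%N -> mix n L = \sum_(j < M) p j * poisQ (n - j) L.
Proof.
move=> nM; rewrite /mix -(subnKC nM) big_split_ord /= [X in _ = _ + X]big1 ?addr0//.
move=> i _; have -> : (n - (n + i) = 0)%N by lia.
by rewrite /poisQ big_ord0 mulr0.
Qed.

Let mass_le1 M : \sum_(j < M) p j <= 1.
Proof. by have := series_nneg_le_lim p 1 M p_ge0 p_sum; rewrite /series /= big_mkord. Qed.

Let mass_ge n (e : R) : 0 < e -> exists2 M, (n <= M)%N & 1 - e <= \sum_(j < M) p j.
Proof.
move=> e0; have /cvgrPdist_le/(_ e e0)[N _ HN] := p_sum.
exists (maxn n N); first exact: leq_maxl.
have := HN (maxn n N) (leq_maxr _ _); rewrite /series /= big_mkord.
have := mass_le1 (maxn n N); set S := \sum_(_ < _) _.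
by rewrite ler_norml => ? /andP[]; lra.
Qed.

Let expR_half : expR (2 * 4^-1) <= 2 :> R.
Proof.
have := expR_ge1Dx (- (2 * 4^-1) : R); rewrite expRN.
have := expR_gt0 (2 * 4^-1 : R).
set e := expR _ => e0 H.
have e1 : e * e^-1 = 1 by rewrite divff// gt_eqF.
by nra.
Qed.

(** E X <= 4, up to the missing mass: expand the generating function at 1 + t to
    first order, with t = 1/4, for which e^(2 t) <= 2. *)
Let mean_le M : \sum_(j < M) p j * j%:R <= 4 * (2 - \sum_(j < M) p j).
Proof.
have t0 : 0 <= (4^-1 : R) <= 2^-1 by lra.
have := le_trans (p_exp _ t0 M) expR_half.
have : \sum_(j < M) (p j + 4^-1 * (p j * j%:R)) <= \sum_(j < M) p j * (1 + 4^-1) ^+ j.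
  apply: ler_sum => j _.
  have : 1 + 4^-1 * j%:R <= (1 + 4^-1 : R) ^+ j.
    elim: (j : nat) => [|k IH]; first by rewrite expr0 mulr0 addr0.
    rewrite exprS -[k.+1%:R]natr1; have : (0:R) <= k%:R by []. lra.
  by move=> /(ler_wpM2l (p_ge0 j)); lra.
rewrite big_split /= -mulr_sumr; lra.
Qed.

Lemma mixture_le m L : 0 <= L -> mix m.+1 L <= poisQ m.+1 L.
Proof.
move=> L0; apply: (@le_trans _ _ (\sum_(j < m.+1) p j * poisQ m.+1 L)).
  apply: ler_sum => j _; rewrite ler_wpM2l// !poisQ_series ler_wpM2l ?expR_ge0//.
  apply: series_nneg_le; last exact: leq_subr.
  by move=> n; rewrite /exp_coeff /= divr_ge0 ?exprn_ge0.
by rewrite -mulr_suml ler_piMl ?poisQ_ge0.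
Qed.

Lemma mixture_ge m L : m%:R <= L -> poisQ m.+1 L - 4 * pois m L <= mix m.+1 L.
Proof.
move=> mL; have L0 : 0 <= L by apply: le_trans mL.
have g0 := pois_ge0 m L L0.
have Q0 := poisQ_ge0 m.+1 L L0.
apply/ler_addgt0Pl => e e0.
pose K := 1 + poisQ m.+1 L + 4 * pois m L.
have K0 : 0 < K by rewrite /K; lra.
have [M mM HM] := mass_ge m.+1 _ (divr_gt0 e0 K0).
rewrite (mixE _ _ _ mM).
have : \sum_(j < M) p j * (poisQ m.+1 L - j%:R * pois m L) <=
    \sum_(j < M) p j * poisQ (m.+1 - j) L.
  by apply: ler_sum => j _; rewrite ler_wpM2l// poisQ_sub_lipschitz.
have -> : \sum_(j < M) p j * (poisQ m.+1 L - j%:R * pois m L) =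
   (\sum_(j < M) p j) * poisQ m.+1 L - (\sum_(j < M) p j * j%:R) * pois m L.
  by rewrite !mulr_suml -sumrB; apply: eq_bigr => j _; ring.
have := mean_le M; move: HM; set S := \sum_(j < M) p j; set E := \sum_(j < M) p j * _.
set T := \sum_(_ < M) _ => HS HE HT.
have eK : e / K * K = e by rewrite mulfVK// gt_eqF.
have d0 : 0 < e / K by rewrite divr_gt0.
have h1 : E * pois m L <= 4 * (1 + e / K) * pois m L by rewrite ler_wpM2r//; lra.
have h2 : (1 - e / K) * poisQ m.+1 L <= S * poisQ m.+1 L by rewrite ler_wpM2r.
have : e / K * (poisQ m.+1 L + 4 * pois m L) <= e.
  by rewrite -[leRHS]eK ler_pM2l// /K; lra.
by lra.
Qed.

Lemma mixture_compl_le m L : 0 < L -> pois m L <= 2^-1 * poisB m.+1 L ->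
  1 - mix m.+1 L <= expR (2 * (pois m L / poisB m.+1 L)) * poisB m.+1 L.
Proof.
move=> L0; have B0 := poisB_gt0 m.+1 L L0.
rewrite -ler_pdivrMr// => t1.
set t := pois m L / poisB m.+1 L in t1 *.
have t0 : 0 <= t by rewrite divr_ge0 ?ltW// pois_gt0.
apply/ler_addgt0Pl => e e0.
have [M mM HM] := mass_ge m.+1 e e0.
rewrite (mixE _ _ _ mM).
have : \sum_(j < M) p j * poisB (m.+1 - j) L <= \sum_(j < M) p j * (1 + t) ^+ j * poisB m.+1 L.
  by apply: ler_sum => j _; rewrite -mulrA ler_wpM2l// poisB_geom.
rewrite -mulr_suml.
have : (\sum_(j < M) p j * (1 + t) ^+ j) * poisB m.+1 L <= expR (2 * t) * poisB m.+1 L.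
  by rewrite ler_pM2r// p_exp// t0.
have -> : \sum_(j < M) p j * poisB (m.+1 - j) L =
   \sum_(j < M) p j - \sum_(j < M) p j * poisQ (m.+1 - j) L.
  by rewrite -sumrB; apply: eq_bigr => j _; rewrite /poisB; ring.
by lra.
Qed.

End Mixture.

(** * The number of digits at most N *)

Section Reciprocals.
Context {R : realType}.
Implicit Types (n m k N : nat) (t : R).

Definition reciprocals j N : seq R := [seq k%:R^-1 | k <- index_iota j N.+1].

Definition harm N : R := \sum_(a <- reciprocals 2 N) a.

(** P(q_n > N), see [engel_digit_tail]. *)
Definition engel_tail n N : R := N%:R^-1 * series (complete_hom (reciprocals 2 N)) n.

Lemma reciprocalsP N a : a \in reciprocals 2 N -> 0 <= a /\ a <= 2^-1.
Proof.
move=> /mapP[k]; rewrite mem_index_iota => /andP[k2 _] ->.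
by rewrite invr_ge0 ler0n lef_pV2 ?posrE ?ltr0n ?ler_nat// (leq_trans _ k2).
Qed.

Lemma prod_reciprocals N (F : R -> R) : (0 < N)%N ->
  \prod_(a <- reciprocals 2 N.+1) F a = (\prod_(a <- reciprocals 2 N) F a) * F N.+1%:R^-1.
Proof. by move=> N0; rewrite /reciprocals !big_map big_nat_recr. Qed.

Lemma prod_reciprocals1 (F : R -> R) : \prod_(a <- reciprocals 2 1) F a = 1.
Proof. by rewrite /reciprocals big_map big_geq. Qed.

Lemma harmS N : (0 < N)%N -> harm N.+1 = harm N + N.+1%:R^-1.
Proof. by move=> N0; rewrite /harm /reciprocals !big_map big_nat_recr. Qed.

Lemma harm1 : harm 1 = 0.
Proof. by rewrite /harm /reciprocals big_map big_geq. Qed.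

Lemma prod_onem_reciprocals N : (0 < N)%N -> \prod_(a <- reciprocals 2 N) (1 - a) = N%:R^-1.
Proof.
case: N => // N _; elim: N => [|N IH]; first by rewrite prod_reciprocals1 invr1.
rewrite prod_reciprocals// IH -[N.+2%:R]natr1.
have n0 : 0 < N.+1%:R :> R by rewrite ltr0n.
by move: (N.+1%:R : R) n0 => x x0; field; rewrite !gt_eqF//; lra.
Qed.

Lemma harm_le N : (0 < N)%N -> harm N <= ln N%:R.
Proof.
case: N => // N _; elim: N => [|N IH]; first by rewrite harm1 ln1.
rewrite harmS//.
have n0 : 0 < N.+1%:R :> R by rewrite ltr0n.
have n1 : 0 < N.+2%:R :> R by rewrite ltr0n.
have : ln (N.+1%:R / N.+2%:R) <= - N.+2%:R^-1 :> R.
  have -> : N.+1%:R / N.+2%:R = 1 + - N.+2%:R^-1 :> R.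
    by rewrite -[in N.+1%:R](subrK 1 N.+1%:R) -[N.+2%:R]natr1; field; rewrite gt_eqF//; lra.
  apply: le_ln1Dx; rewrite ltrN2 invf_lt1// ltr1n//.
rewrite ln_div ?posrE//; move: IH.
by move: (ln _) (ln _) (_^-1) (harm _) => a b c d; lra.
Qed.

Lemma harm_ge N : (0 < N)%N -> ln N.+1%:R - 1 <= harm N.
Proof.
case: N => // N _; elim: N => [|N IH].
  have /le_ln1Dx : -1 < 1 :> R by lra.
  by rewrite harm1 -[2%:R]/(1 + 1); lra.
rewrite harmS//.
have n0 : 0 < N.+3%:R :> R by rewrite ltr0n.
have n1 : 0 < N.+2%:R :> R by rewrite ltr0n.
have : ln (N.+3%:R / N.+2%:R) <= N.+2%:R^-1 :> R.
  have -> : N.+3%:R / N.+2%:R = 1 + N.+2%:R^-1 :> R.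
    by rewrite -[N.+3%:R]natr1; field; rewrite gt_eqF.
  by apply: le_ln1Dx; apply: lt_trans (_ : 0 < _); rewrite ?oppr_lt0 ?invr_gt0.
rewrite ln_div ?posrE//; move: IH.
by move: (ln _) (ln _) (_^-1) (harm _) => a b c d; lra.
Qed.

(** The law of the excess: the normalising constant is the value at t = 1 of
    the reciprocal of the product in [excesses_cvg]. *)
Let w N j : R := (\prod_(a <- reciprocals 2 N) ((1 - a) * expR a)) * excesses (reciprocals 2 N) j.

Let w_ge0 N j : 0 <= w N j.
Proof.
rewrite /w mulr_ge0//; last by apply: excesses_ge0 => a /reciprocalsP[].
rewrite big_seq; apply: prodr_ge0 => a /reciprocalsP[a0 a1].
by rewrite mulr_ge0 ?expR_ge0// subr_ge0; lra.
Qed.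

Let w_cvg N t : 0 <= t < 2 ->
  series (fun j => w N j * t ^+ j) @ \oo -->
  \prod_(a <- reciprocals 2 N) ((1 - a) * expR (a * (1 - t)) / (1 - a * t)).
Proof.
move=> /andP[t0 t2].
have -> : \prod_(a <- reciprocals 2 N) ((1 - a) * expR (a * (1 - t)) / (1 - a * t)) =
  (\prod_(a <- reciprocals 2 N) ((1 - a) * expR a)) *
  \prod_(a <- reciprocals 2 N) (expR (- (a * t)) / (1 - a * t)).
  rewrite -big_split; apply: eq_bigr => a _ /=.
  have -> : a * (1 - t) = a + - (a * t) by ring.
  by rewrite expRD; ring.
have -> : series (fun j => w N j * t ^+ j) =
  (fun n => (\prod_(a <- reciprocals 2 N) ((1 - a) * expR a)) *
     series (fun n => excesses (reciprocals 2 N) n * t ^+ n) n).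
  apply/funext => n; rewrite /series /= mulr_sumr; apply: eq_bigr => i _.
  by rewrite /w mulrA.
apply: cvgM; first exact: cvg_cst.
apply: excesses_cvg => // a /reciprocalsP[a0 a1]; split => //.
by nra.
Qed.

Let w_sum N : series (w N) @ \oo --> (1 : R).
Proof.
have := @w_cvg N 1; rewrite ler01 ltr1n => /(_ isT).
have -> : (fun j => w N j * 1 ^+ j) = w N.
  by apply/funext => j; rewrite expr1n mulr1.
rewrite big_seq big1// => a /reciprocalsP[a0 a1].
by rewrite subrr mulr0 expR0 !mulr1 divff// gt_eqF//; lra.
Qed.

(** With u = t / k the factor equals exp(- t / (k + 1)) / (1 - u), and
    1 / (1 - u) <= exp(u + u ^ 2).  The bound is in a form that telescopes over
    k. *)
Let factor_le t (k : nat) : 0 <= t <= 2^-1 -> (0 < k)%N ->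
  (1 - k.+1%:R^-1) * expR (k.+1%:R^-1 * (1 - (1 + t))) / (1 - k.+1%:R^-1 * (1 + t))
   <= expR (2 * t * (k%:R^-1 - k.+1%:R^-1)).
Proof.
move=> /andP[t0 t1] k0; rewrite -natr1.
have x1 : 1 <= k%:R :> R by rewrite ler1n.
move: (k%:R : R) x1 => x x1.
pose u := t / x.
have x0 : 0 < x by lra.
have ux : u * x = t by rewrite /u mulfVK// gt_eqF.
have u0 : 0 <= u by rewrite /u divr_ge0// ltW.
have u1 : u <= 2^-1 by nra.
have -> : (1 - (x + 1)^-1) * expR ((x + 1)^-1 * (1 - (1 + t))) / (1 - (x + 1)^-1 * (1 + t))
  = expR (- (t / (x + 1))) / (1 - u).
  have -> : (x + 1)^-1 * (1 - (1 + t)) = - (t / (x + 1)) by ring.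
  have d1 : x + 1 != 0 by rewrite gt_eqF//; lra.
  have d2 : x - t != 0 by rewrite gt_eqF//; lra.
  have d3 : x != 0 by rewrite gt_eqF.
  by rewrite /u; field; rewrite d1 d2 d3.
rewrite ler_pdivrMr; last by lra.
have E1 : 1 <= expR (u + u ^+ 2) * (1 - u).
  have v0 : 0 <= u + u ^+ 2 by rewrite addr_ge0 ?sqr_ge0.
  have := expR_ge_quad _ v0; nra.
have E2 : u + u ^+ 2 - t / (x + 1) <= 2 * t * (x^-1 - (x + 1)^-1).
  have -> : x^-1 - (x + 1)^-1 = (x * (x + 1))^-1.
    by field; rewrite !gt_eqF//; lra.
  have -> : u + u ^+ 2 - t / (x + 1) = (u * x + t * u * (x + 1)) * (x * (x + 1))^-1.
    by rewrite -ux; field; rewrite !gt_eqF//; lra.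
  rewrite ler_pM2r ?invr_gt0 ?mulr_gt0//; last by lra.
  by rewrite ux; nra.
have : expR (u + u ^+ 2 - t / (x + 1)) <= expR (2 * t * (x^-1 - (x + 1)^-1)).
  by rewrite ler_expR.
rewrite expRD => H.
apply: le_trans (_ : expR (u + u ^+ 2) * expR (- (t / (x + 1))) * (1 - u) <= _).
  by rewrite mulrAC ler_peMl ?expR_ge0.
by rewrite ler_wpM2r//; lra.
Qed.

Let w_exp N t : (0 < N)%N -> 0 <= t <= 2^-1 -> forall M,
  \sum_(j < M) w N j * (1 + t) ^+ j <= expR (2 * t).
Proof.
move=> N0 t01 M; have /andP[t0 t1] := t01.
have t2 : 0 <= 1 + t < 2 by lra.
have := series_nneg_le_lim _ _ M _ (w_cvg N _ t2).
rewrite /series /= big_mkord => H; apply: le_trans (H _) _ => {H}.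
  by move=> j; rewrite mulr_ge0// exprn_ge0//; lra.
have : \prod_(a <- reciprocals 2 N) ((1 - a) * expR (a * (1 - (1 + t))) / (1 - a * (1 + t))) <=
   expR (2 * t * (1 - N%:R^-1)).
  case: N N0 => // N _; elim: N => [|N IH].
    by rewrite prod_reciprocals1 invr1 subrr mulr0 expR0.
  rewrite prod_reciprocals//.
  have -> : 2 * t * (1 - N.+2%:R^-1) = 2 * t * (1 - N.+1%:R^-1) + 2 * t * (N.+1%:R^-1 - N.+2%:R^-1).
    by ring.
  rewrite expRD; apply: ler_pM => //; last exact: factor_le.
    rewrite big_seq; apply: prodr_ge0 => a /reciprocalsP[a0 a1].
    by rewrite divr_ge0 ?mulr_ge0 ?expR_ge0// subr_ge0; nra.
  have i0 : 0 < N.+2%:R^-1 :> R by rewrite invr_gt0 ltr0n.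
  have i1 : N.+2%:R^-1 <= 2^-1 :> R by rewrite lef_pV2 ?posrE ?ltr0n// ler_nat.
  move: (N.+2%:R^-1 : R) i0 i1 => i i0 i1.
  by rewrite divr_ge0 ?mulr_ge0 ?expR_ge0// subr_ge0; nra.
move/le_trans; apply; rewrite ler_expR.
have : 0 <= N%:R^-1 :> R by rewrite invr_ge0.
by nra.
Qed.

Let engel_tailE n N : (0 < N)%N ->
  engel_tail n N = \sum_(j < n) w N j * poisQ (n - j) (harm N).
Proof.
move=> N0; rewrite /engel_tail complete_hom_excesses series_conv mulr_sumr.
apply: eq_bigr => j _; rewrite poisQ_series -/(harm N) /w big_split /=.
rewrite prod_onem_reciprocals// -expR_sum -/(harm N) expRN.
have e0 : expR (harm N) != 0 by rewrite gt_eqF ?expR_gt0.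
move: (series _ _) (excesses _ _) (expR _) (_^-1) e0 => x y z v z0.
by field.
Qed.

Lemma engel_tail_le m N : (0 < N)%N -> 0 <= harm N ->
  engel_tail m.+1 N <= poisQ m.+1 (harm N).
Proof. by move=> N0 h0; rewrite engel_tailE//; apply: mixture_le. Qed.

Lemma engel_tail_ge m N : (0 < N)%N -> m%:R <= harm N ->
  poisQ m.+1 (harm N) - 4 * pois m (harm N) <= engel_tail m.+1 N.
Proof.
by move=> N0 h0; rewrite engel_tailE//; apply: mixture_ge => // t t0 M; apply: w_exp.
Qed.

Lemma engel_head_le m N : (0 < N)%N -> 0 < harm N ->
  pois m (harm N) <= 2^-1 * poisB m.+1 (harm N) ->
  1 - engel_tail m.+1 N <=
    expR (2 * (pois m (harm N) / poisB m.+1 (harm N))) * poisB m.+1 (harm N).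
Proof.
by move=> N0 h0 H; rewrite engel_tailE//; apply: mixture_compl_le => // t t0 M; apply: w_exp.
Qed.

End Reciprocals.

(** * Engel expansions *)

Section Engel.
Context {R : realType}.
Implicit Types (x : R) (e : nat -> nat) (i j n N k : nat).

(** [sz e n.+1] is the n-th term of the Engel series. *)
Let sz e n : R := (\prod_(i < n) (e i)%:R)^-1.

Let sz_tail e n : sz e n.+1 = (e 0%N)%:R^-1 * sz (fun i => e i.+1) n.
Proof. by rewrite /sz big_ord_recl invfM. Qed.

(** The sum exceeds its first term; it is at most the geometric series of ratio
    1 / q_1, since the later digits are at least q_1. *)
Lemma engel_first_digit x e : is_engel_expansion x e ->
  (e 0%N)%:R^-1 < x /\ x <= (e 0%N).-1%:R^-1.
Proof.
move=> [e2 em ex].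
have e_ge i : (e 0%N <= e i)%N.
  by elim: i => // i IH; exact: leq_trans IH (em i).
have sz0 n : 0 <= sz e n by rewrite /sz invr_ge0 prodr_ge0.
have ser n : series (fun n => sz e n.+1) n <= x.
  exact: series_nneg_le_lim.
split.
  apply: lt_le_trans (ser 2%N).
  rewrite /series /= !big_nat_recr //= big_geq // add0r.
  rewrite /sz !big_ord_recr !big_ord0 /= !mul1r ltrDl invr_gt0 mulr_gt0 ?ltr0n//.
    exact: leq_trans (e2 0%N).
  exact: leq_trans (e2 1%N).
set q := e 0%N in e_ge *.
have q2 : (2 <= q)%N by exact: e2.
have qR : 2 <= q%:R :> R by rewrite ler_nat.
have -> : q.-1%:R = q%:R - 1 :> R by rewrite -subn1 natrB// (leq_trans _ q2).
have up n : series (fun n => sz e n.+1) n <= (q%:R - 1)^-1 * (1 - q%:R^-1 ^+ n).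
  elim: n => [|n IH]; first by rewrite /series /= big_geq// expr0 subrr mulr0.
  rewrite seriesSr.
  have : sz e n.+1 <= q%:R^-1 ^+ n.+1.
    rewrite /sz exprVn lef_pV2 ?posrE ?exprn_gt0 ?prodr_gt0 ?ltr0n//; last first.
    - by rewrite (leq_trans _ q2).
    - by move=> i _; rewrite ltr0n (leq_trans _ (e2 i)).
    rewrite -[n.+1 in leLHS]card_ord -prodr_const; apply: ler_prod => i _.
    by rewrite ler0n ler_nat e_ge.
  have -> : (q%:R - 1)^-1 * (1 - q%:R^-1 ^+ n.+1) =
     (q%:R - 1)^-1 * (1 - q%:R^-1 ^+ n) + q%:R^-1 ^+ n.+1 :> R.
    rewrite exprS; move: (_ ^+ n) => y; field.
    by rewrite !gt_eqF//; lra.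
  by lra.
have cx : cvgn (series (fun n => sz e n.+1)) by apply/cvg_ex; exists x.
rewrite -(cvg_lim _ ex)//; apply: limr_le => //; apply: nearW => n.
apply: le_trans (up n) _; rewrite ler_piMr ?gerBl ?exprn_ge0 ?invr_ge0//.
by lra.
Qed.

Lemma engel_behead x e : is_engel_expansion x e ->
  is_engel_expansion ((e 0%N)%:R * x - 1) (fun i => e i.+1).
Proof.
move=> [e2 em ex]; split; [by move=> i; exact: e2|by move=> i; exact: em|].
have q0 : (e 0%N)%:R != 0 :> R.
  by rewrite pnatr_eq0 -lt0n; apply: leq_trans (e2 0%N).
have E n : series (fun n => sz (fun i => e i.+1) n.+1) n =
    (e 0%N)%:R * series (fun n => sz e n.+1) n.+1 - 1.
  rewrite /series /= big_nat_recl// mulrDr.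
  rewrite {2}/sz big_ord1 divff// addrAC subrr add0r mulr_sumr.
  by apply: eq_bigr => i _; rewrite [in RHS]sz_tail mulrA divff// mul1r.
rewrite (_ : series _ = fun n => (e 0%N)%:R * series (fun n => sz e n.+1) n.+1 - 1); last first.
  by apply/funext => n; rewrite -E.
apply: cvgB; last exact: cvg_cst.
apply: cvgM; first exact: cvg_cst.
by rewrite (cvg_shiftS (series (fun n => sz e n.+1))).
Qed.

Lemma recip_slot_uniq x j k : (0 < j)%N -> (0 < k)%N ->
  j%:R^-1 < x -> x <= j.-1%:R^-1 -> k%:R^-1 < x -> x <= k.-1%:R^-1 -> j = k.
Proof.
move=> j0 k0 j1 j2 k1 k2.
wlog jk : j k j0 k0 j1 j2 k1 k2 / (j <= k)%N.
  move=> H; have [jk|kj] := leqP j k; first exact: H.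
  by apply/esym; apply: H => //; exact: ltnW.
move: jk; rewrite leq_eqVlt => /orP[/eqP//|jk].
have : x <= j%:R^-1.
  apply: le_trans k2 _; rewrite lef_pV2 ?posrE ?ltr0n// ?ler_nat.
    by rewrite -ltnS prednK.
  by rewrite -ltnS prednK// (leq_ltn_trans j0).
by rewrite leNgt j1.
Qed.

Lemma engel_uniq x e e' : is_engel_expansion x e -> is_engel_expansion x e' -> e = e'.
Proof.
have E0 (y : R) f g : is_engel_expansion y f -> is_engel_expansion y g -> f 0%N = g 0%N.
  move=> ey fy; have [a b] := engel_first_digit _ _ ey; have [c d] := engel_first_digit _ _ fy.
  apply: (recip_slot_uniq y) => //.
    by case: ey => /(_ 0%N)/ltnW.
  by case: fy => /(_ 0%N)/ltnW.
move=> ex ex'; apply/funext => i.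
elim: i x e e' ex ex' => [|i IH] x e e' ex ex'; first exact: E0 ex ex'.
have := engel_behead _ _ ex; have := engel_behead _ _ ex'.
rewrite (E0 _ _ _ ex ex') => A B.
exact: (IH _ _ _ B A).
Qed.

(** The Engel algorithm: K x is the first digit of x, and T x is the point
    expanded by the remaining digits. *)
Let K x : nat := (Num.truncn x^-1).+1.
Let T x : R := (K x)%:R * x - 1.

Let K_bounds x : 0 < x <= 1 ->
  [/\ (2 <= K x)%N, (K x)%:R^-1 < x & x <= (K x).-1%:R^-1].
Proof.
move=> /andP[x0 x1].
have i1 : 1 <= x^-1 by rewrite invf_ge1.
have i0 : 0 <= x^-1 by rewrite ltW// invr_gt0.
have t1 : (1 <= Num.truncn x^-1)%N by rewrite truncn_gt0.
have /andP[ta tb] := truncn_itv i0.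
split; first by rewrite /K ltnS.
  by rewrite invf_plt ?posrE ?ltr0n.
by rewrite /K /= -[leLHS]invrK lef_pV2 ?posrE ?invr_gt0 ?ltr0n.
Qed.

Let T_bounds x : 0 < x <= 1 -> 0 < T x /\ T x <= (K x).-1%:R^-1.
Proof.
move=> x01; have [K2 Kl Ku] := K_bounds _ x01.
have k0 : 0 < (K x)%:R :> R by rewrite ltr0n (leq_trans _ K2).
rewrite /T; split.
  by rewrite subr_gt0 -(ltr_pdivrMl _ _ k0) mulr1.
have k1 : 0 < (K x).-1%:R :> R by rewrite ltr0n -ltnS prednK// (leq_trans _ K2).
have -> : (K x).-1%:R^-1 = (K x)%:R * (K x).-1%:R^-1 - 1 :> R.
  have -> : (K x)%:R = (K x).-1%:R + 1 :> R by rewrite natr1 prednK// (leq_trans _ K2).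
  by field; rewrite gt_eqF.
by rewrite lerD2r ler_pM2l.
Qed.

Let T01 x : 0 < x <= 1 -> 0 < T x <= 1.
Proof.
move=> x01; have [t0 t1] := T_bounds _ x01; rewrite t0 /=.
apply: le_trans t1 _; have [K2 _ _] := K_bounds _ x01.
have k1 : (1 <= (K x).-1)%N by rewrite -ltnS prednK// (leq_trans _ K2).
by rewrite invf_le1 ?ler1n// ltr0n.
Qed.

(** After n steps the remainder is T^n x / (q_1 ... q_n) <= 2 ^- n. *)
Lemma engel_exists x : 0 < x <= 1 -> exists e, is_engel_expansion x e.
Proof.
move=> x01; pose e i := K (iter i T x); exists e.
have it i : 0 < iter i T x <= 1 by elim: i => // i IH; rewrite iterS; exact: T01.
have e2 i : (2 <= e i)%N by have [] := K_bounds _ (it i).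
have em i : (e i <= e i.+1)%N.
  rewrite /e iterS; set y := iter i T x.
  have y01 : 0 < y <= 1 by exact: it.
  have [t0 t1] := T_bounds _ y01.
  have [_ kl _] := K_bounds _ (T01 _ y01).
  have := lt_le_trans kl t1.
  have k1 : (0 < (K y).-1)%N by have := e2 i; rewrite /e -/y; case: (K y) => // -[].
  by rewrite ltf_pV2 ?posrE ?ltr0n// ltr_nat prednK.
split => //.
have E n : series (fun n => sz e n.+1) n = x - iter n T x * sz e n.
  elim: n => [|n IH]; first by rewrite /series /= big_geq// /sz big_ord0 invr1 mulr1 subrr.
  rewrite seriesSr IH iterS {2}/T -/(e n).
  have q0 : (e n)%:R != 0 :> R by rewrite pnatr_eq0 -lt0n; apply: leq_trans (e2 n).
  rewrite [sz e n.+1](_ : _ = sz e n / (e n)%:R); last by rewrite /sz big_ord_recr invfM.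
  by field.
have -> : series (fun n => (\prod_(i < n.+1) ((e i)%:R : R))^-1) =
   fun n => x - iter n T x * sz e n by apply/funext => n; rewrite -E.
rewrite -[x in X in _ --> X]subr0; apply: cvgB; first exact: cvg_cst.
apply: (@squeeze_cvgr _ _ _ _ (fun=> 0) (fun n => 2^-1 ^+ n)).
- apply: nearW => n; have /andP[i0 i1] := it n.
  have sz0 : 0 <= sz e n by rewrite /sz invr_ge0 prodr_ge0.
  rewrite mulr_ge0 ?(ltW i0)//=.
  apply: (@le_trans _ _ (sz e n)); first by rewrite ler_piMl.
  have p0 : 0 < \prod_(i < n) (e i)%:R :> R.
    by apply: prodr_gt0 => i _; rewrite ltr0n (leq_trans _ (e2 i)).
  rewrite /sz exprVn lef_pV2 ?posrE ?exprn_gt0//.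
  rewrite -[n in leLHS]card_ord -prodr_const; apply: ler_prod => i _.
  by rewrite ler0n ler_nat e2.
- exact: cvg_cst.
- by apply: cvg_expr; rewrite ger0_norm; lra.
Qed.

Lemma engel_expansionP x : 0 < x <= 1 -> is_engel_expansion x (engel_expansion x).
Proof. by move=> /engel_exists[e He]; exact: (xgetPex (fun=> 2%N) (ex_intro _ e He)). Qed.

Lemma engel_expansion_out x i : ~~ (0 < x <= 1) -> engel_expansion x i = 2%N.
Proof.
move=> xn; rewrite /engel_expansion xgetPN// => e ex.
have [h1 h2] := engel_first_digit _ _ ex.
case: ex => e2 _ _; move/negP : xn; apply.
rewrite (lt_trans _ h1) ?invr_gt0 ?ltr0n ?(leq_trans _ (e2 0%N))//=.
apply: le_trans h2 _; have := e2 0%N; case: (e 0%N) => // -[//|q] _ /=.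
by rewrite invf_le1 ?ler1n ?ltr0n.
Qed.

Lemma engel_expansion0 x j : (0 < j)%N -> 0 < x <= 1 ->
  j%:R^-1 < x -> x <= j.-1%:R^-1 -> engel_expansion x 0 = j.
Proof.
move=> j0 x01 j1 j2; have ex := engel_expansionP _ x01.
have [h1 h2] := engel_first_digit _ _ ex.
by apply: (recip_slot_uniq x) => //; case: ex => /(_ 0%N)/ltnW.
Qed.

Lemma engel_expansionS x i : 0 < x <= 1 ->
  engel_expansion x i.+1 = engel_expansion ((engel_expansion x 0)%:R * x - 1) i.
Proof.
move=> x01; have ex := engel_expansionP _ x01.
have bx := engel_behead _ _ ex.
have E : engel_expansion ((engel_expansion x 0)%:R * x - 1) = (fun i => engel_expansion x i.+1).
  apply: (engel_uniq _ _ _ _ bx); apply: engel_expansionP.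
  have [h1 h2] := engel_first_digit _ _ bx; case: bx => e2 _ _.
  rewrite (lt_trans _ h1) ?invr_gt0 ?ltr0n ?(leq_trans _ (e2 0%N))//=.
  apply: le_trans h2 _; have := e2 0%N; case: (engel_expansion x 1) => // -[//|q] _ /=.
  by rewrite invf_le1 ?ler1n ?ltr0n.
by rewrite E.
Qed.

End Engel.

(** * The law of an Engel digit *)

Section EngelMeasure.
Context {R : realType}.
Implicit Types (A B : set R) (v l r k : R) (n j N i : nat).
Local Notation mu := (@lebesgue_measure R).

(** Finite disjoint unions of half-open intervals, together with their length.
    As an inductive family they are stable under affine preimages by a direct
    induction. *)
Inductive itv_union : set R -> R -> Prop :=
| itv_union1 l r : l <= r -> itv_union `]l, r]%classic (r - l)
| itv_unionU A B v w : itv_union A v -> itv_union B w -> A `&` B = set0 ->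
    itv_union (A `|` B) (v + w).

Lemma itv_union_affine A v k : 0 < k -> itv_union A v ->
  itv_union [set x | A (k * x - 1)] (k^-1 * v).
Proof.
move=> k0; elim=> {A v} [l r lr|A B v w _ IA _ IB AB].
  have -> : [set x | `]l, r]%classic (k * x - 1)] = `](l + 1) / k, (r + 1) / k]%classic.
    apply/seteqP; split => x /=; rewrite !in_itv /=.
      move=> /andP[h1 h2]; apply/andP; split.
        by rewrite ltr_pdivrMr// mulrC; lra.
      by rewrite ler_pdivlMr// mulrC; lra.
    move=> /andP[]; rewrite ltr_pdivrMr// ler_pdivlMr// [x * k]mulrC => h1 h2.
    by apply/andP; split; lra.
  have -> : k^-1 * (r - l) = (r + 1) / k - (l + 1) / k by ring.
  by apply: itv_union1; rewrite ler_pM2r ?invr_gt0//; lra.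
rewrite mulrDr.
have -> : [set x | (A `|` B) (k * x - 1)] =
  [set x | A (k * x - 1)] `|` [set x | B (k * x - 1)] by [].
apply: itv_unionU => //; apply/seteqP; split => // x [/= Ax Bx].
by have : (A `&` B) (k * x - 1) by []; rewrite AB.
Qed.

Lemma itv_union_measure A v : itv_union A v -> measurable A /\ mu A = v%:E.
Proof.
elim=> {A v} [l r lr|A B v w _ [mA muA] _ [mB muB] AB].
  split => //; rewrite lebesgue_measure_itv/= lte_fin.
  by move: lr; rewrite le_eqVlt => /orP[/eqP ->|->//]; rewrite ltxx subrr.
split; first exact: measurableU.
transitivity (mu A + mu B)%E; first exact: measureU.
by rewrite muA muB.
Qed.

Lemma unif01E A : measurable A -> A `<=` `[0, 1]%classic -> unif01 R A = mu A.
Proof.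
move=> mA A01; have -> : unif01 R A = (\int[mu]_(x in A) (uniform_pdf 0 1 x)%:E)%E by [].
rewrite integral_uniform_pdf setIidl//.
rewrite (eq_integral (fun=> 1%E)).
  by rewrite integral_cst// mul1e.
by move=> x; rewrite inE => /A01 /=; rewrite in_itv /= /uniform_pdf subr0 invr1 => ->.
Qed.

(** The points all of whose digits are at least j, and whose digit of index n
    (counted from 0) exceeds N. *)
Let D n j N : set R := [set x | 0 < x <= j.-1%:R^-1 /\ (N < engel_expansion x n)%N].

(** For n > 0, the length of [D n.-1 j N]. *)
Let V n j N : R := N%:R^-1 * series (complete_hom (reciprocals j N)) n.

Let engel_ge (x : R) i : 0 < x <= 1 -> (engel_expansion x 0 <= engel_expansion x i)%N.
Proof.
move=> /engel_expansionP[_ em _]; elim: i => // i IH.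
exact: leq_trans IH (em i).
Qed.

Let slot01 (x : R) j : (1 < j)%N -> 0 < x <= j.-1%:R^-1 -> 0 < x <= 1.
Proof.
move=> j1 /andP[-> /= h]; apply: le_trans h _; case: j j1 => // -[//|j] _ /=.
by rewrite invf_le1 ?ler1n ?ltr0n.
Qed.

(** If all digits are at least N + 1, they all exceed N. *)
Let D_last n N : (0 < N)%N -> D n N.+1 N = `]0, N%:R^-1]%classic.
Proof.
move=> N0; apply/seteqP; split => x /=; first by rewrite in_itv /= => -[].
rewrite in_itv /= => x0.
split => //; have x01 := slot01 x N.+1 N0 x0.
apply: leq_trans (engel_ge x n x01).
have [h1 _] := engel_first_digit _ _ (engel_expansionP _ x01).
have e2 : (2 <= engel_expansion x 0)%N by case: (engel_expansionP _ x01).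
move: x0 => /andP[_ /(lt_le_trans h1)].
by rewrite ltf_pV2 ?posrE ?ltr0n ?ltr_nat// (leq_trans _ e2).
Qed.

(** Either the first digit is at least j + 1; or it is j, the point j x - 1 is
    expanded by the remaining digits, and it ranges over all points whose digits
    are at least j. *)
Let D_split n j N : (1 < j)%N -> (j <= N)%N ->
  D n j N = D n j.+1 N `|`
    (if n is i.+1 then [set x | D i j N (j%:R * x - 1)] else set0).
Proof.
move=> j1 jN.
have j0 : 0 < j%:R :> R by rewrite ltr0n (leq_trans _ j1).
have j10 : 0 < j.-1%:R :> R by rewrite ltr0n -ltnS prednK// (leq_trans _ j1).
have jE : j%:R = j.-1%:R + 1 :> R by rewrite natr1 prednK// (leq_trans _ j1).
have aff (x : R) : (0 < j%:R * x - 1 <= j.-1%:R^-1) = (j%:R^-1 < x <= j.-1%:R^-1).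
  congr (_ && _); first by rewrite subr_gt0 -(ltr_pdivrMl _ _ j0) mulr1.
  rewrite lerBlDr.
  have -> : j.-1%:R^-1 + 1 = j%:R * j.-1%:R^-1 :> R by rewrite jE; field; rewrite gt_eqF.
  by rewrite ler_pM2l.
apply/seteqP; split => x.
- move=> [x01 Nx]; have x1 := slot01 x j j1 x01.
  have [xj|xj] := leP x j%:R^-1.
    by left; split => //=; rewrite xj andbT; case/andP: x01.
  have E0 : engel_expansion x 0 = j.
    by apply: engel_expansion0 => //; [exact: leq_trans j1|case/andP: x01].
  right; case: n Nx => [|n].
    by rewrite /= E0 ltnNge jN.
  rewrite (engel_expansionS _ _ x1) E0 => Nx; split; last exact: Nx.
  by rewrite aff xj; case/andP: x01.
- case=> [[x01 Nx]|].
    split => //; move: x01 => /= /andP[-> h] /=; apply: le_trans h _.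
    by rewrite lef_pV2 ?posrE// ler_nat leq_pred.
  case: n => // n [/= y01 Nx].
  move: (y01); rewrite aff => /andP[h1 h2].
  have x0 : 0 < x by rewrite (lt_trans _ h1)// invr_gt0.
  have x01 : 0 < x <= j.-1%:R^-1 by rewrite x0.
  have x1 := slot01 x j j1 x01.
  split; first exact: x01.
  rewrite (engel_expansionS _ _ x1).
  suff -> : engel_expansion x 0 = j by exact: Nx.
  by apply: engel_expansion0 => //; exact: leq_trans j1.
Qed.

Let reciprocals_cons j N : (j <= N)%N -> reciprocals j N = j%:R^-1 :: reciprocals j.+1 N :> seq R.
Proof. by move=> jN; rewrite /reciprocals /index_iota subSn. Qed.

Let D_step n N : (0 < N)%N ->
  (forall j, (1 < j)%N -> (j <= N)%N -> itv_union
    (if n is i.+1 then [set x | D i j N (j%:R * x - 1)] else set0)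
    (j%:R^-1 * V n j N)) ->
  forall j, (1 < j)%N -> (j <= N.+1)%N -> itv_union (D n j N) (V n.+1 j N).
Proof.
move=> N0 IHn j j1 jN.
have [d] := ubnP (N.+1 - j); elim: d j j1 jN => // d IHd j j1.
rewrite leq_eqVlt => /orP[/eqP -> _|jN dj].
  rewrite D_last// /V /reciprocals /index_iota subnn /=.
  have -> : series delta0 n.+1 = 1 :> R.
    by rewrite /series /= big_nat_recl// big1 ?addr0.
  by rewrite mulr1 -[X in itv_union _ X]subr0; apply: itv_union1; rewrite invr_ge0.
rewrite ltnS in jN.
rewrite D_split// /V reciprocals_cons// series_complete_homS -reciprocals_cons// mulrDr mulrCA.
apply: itv_unionU.
- by apply: IHd; [exact: leqW|rewrite ltnS|lia].
- exact: IHn.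
- apply/seteqP; split => // x [[/= /andP[x0 xj] _]].
  case: (n) => // i [/= /andP[y0 _] _].
  have j0 : 0 < j%:R :> R by rewrite ltr0n (leq_trans _ j1).
  move: y0; rewrite subr_gt0 -(ltr_pdivrMl _ _ j0) mulr1.
  by rewrite ltNge xj.
Qed.

Let D_itv_union n j N : (1 < j)%N -> (j <= N.+1)%N -> (0 < N)%N ->
  itv_union (D n j N) (V n.+1 j N).
Proof.
move=> j1 jN N0; elim: n j j1 jN => [|n IHn] j j1 jN; apply: D_step => // {}j {}j1 {}jN.
  rewrite /V /series /= big_geq// !mulr0 -(subrr (0:R)).
  have -> : set0 = `](0:R), 0]%classic by rewrite set_itvoc0.
  exact: itv_union1.
apply: itv_union_affine; first by rewrite ltr0n (leq_trans _ j1).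
by apply: IHn => //; exact: leqW.
Qed.

(** Outside ]0, 1] the expansion takes the default value 2 <= N, so the event is
    the set [D n.-1 2 N]. *)
Lemma engel_digit_tail n N : (0 < n)%N -> (1 < N)%N ->
  measurable [set x : R | (N < engel_digit n x)%N] /\
  unif01 R [set x | (N < engel_digit n x)%N] = (engel_tail n N)%:E.
Proof.
case: n => // n _ N1; rewrite /engel_digit /=.
have -> : [set x : R | (N < engel_expansion x n)%N] = D n 2 N.
  apply/seteqP; split => x /=; last by case.
  move=> Nx; split => //; rewrite /= invr1; apply/negPn/negP => x01.
  by move: Nx; rewrite engel_expansion_out// ltnNge N1.
have [|mD muD] := itv_union_measure _ _ (@D_itv_union n 2 N isT _ (ltnW N1)).
  exact: leqW.
split => //; rewrite unif01E//.
by move=> x /= [/andP[x0]]; rewrite /= invr1 => x1 _; rewrite in_itv /= (ltW x0).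
Qed.

End EngelMeasure.

(** * Moderate deviations of the two tails *)

Section TailEstimates.
Context {R : realType}.
Implicit Types (h x t L : R) (m n N : nat).

Lemma ln1p_ge h : - (2 / 5) <= h -> h - h ^+ 2 <= ln (1 + h).
Proof.
move=> h1; have p1 : 0 < 1 + h by lra.
rewrite -ler_expR lnK ?posrE//.
have [h0|h0] := leP 0 h.
  have := onePexp_ge h h0; rewrite [expR (- h)]expRN ler_pdivlMr ?expR_gt0// mulrC -expRD => H.
  by apply: le_trans H; rewrite ler_expR; have := sqr_ge0 h; lra.
have u0 : h - h ^+ 2 <= 0 by have := sqr_ge0 h; lra.
apply: le_trans (expR_le_quad _ u0) _.
have -> : (h - h ^+ 2) ^+ 2 / 2 = h ^+ 2 * ((1 - h) ^+ 2 / 2) by ring.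
have : (1 - h) ^+ 2 / 2 <= 1 by nra.
by have := sqr_ge0 h; nra.
Qed.

Lemma expRN2_le_onem h : 0 <= h <= 2^-1 -> expR (- (2 * h)) <= 1 - h.
Proof.
move=> /andP[h0 h1]; have h2 : - (2 * h) <= 0 by lra.
by apply: le_trans (expR_le_quad _ h2) _; nra.
Qed.

(** n = m + 1 is the index of the digit, s and r are the square roots of n and of
    n - 1 (the two centrings above), and i = 1 / s is the size of all error
    terms. *)
Variables (m : nat) (x : R).
Let n : R := m.+1%:R.
Let s : R := Num.sqrt n.
Let r : R := Num.sqrt m%:R.
Hypothesis s_ge : 100 <= s.
Hypothesis x_ge0 : 0 <= x.
Hypothesis x_le : x <= s / 100.

Let nE : n = s ^+ 2. Proof. by rewrite /s sqr_sqrtr. Qed.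
Let mE : m%:R = s ^+ 2 - 1 :> R. Proof. by rewrite -nE /n -natr1 addrK. Qed.
Let ss_ge : 100 * 100 <= s ^+ 2.
Proof. by rewrite expr2; apply: ler_pM. Qed.
Let m_ge : (100 <= m)%N.
Proof.
by rewrite -(ler_nat R) mE; have := ss_ge; lra.
Qed.
Let m_ge4 : (4 <= m)%N. Proof. exact: leq_trans m_ge. Qed.
Let rE : r ^+ 2 = s ^+ 2 - 1. Proof. by rewrite /r sqr_sqrtr// mE. Qed.
Let r_ge0 : 0 <= r. Proof. exact: sqrtr_ge0. Qed.
Let s_ge0 : 0 <= s. Proof. exact: sqrtr_ge0. Qed.
Let r_le : r <= s. Proof. by rewrite -ler_sqr ?nnegrE// rE; lra. Qed.
Let r_ge : s / 2 <= r.
Proof.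
rewrite -ler_sqr ?nnegrE ?divr_ge0// rE exprMn.
by have := ss_ge; lra.
Qed.

Let s_gt0 : 0 < s. Proof. by have := s_ge; lra. Qed.

(** All errors are multiples of this; since x and x ^ 2 are dominated by
    x ^ 3 + x + 1, so is, up to a constant, every polynomial of degree 3 in x ([poly_rate]). *)
Definition rate : R := (x ^+ 3 + x + 1) / s.

Let i : R := s^-1.
Let iE : i * s = 1. Proof. by rewrite /i mulVf// gt_eqF. Qed.
Let i_gt0 : 0 < i. Proof. by rewrite invr_gt0. Qed.

Let x3 : 0 <= x ^+ 3. Proof. exact: exprn_ge0. Qed.
Let x2 : x ^+ 2 <= x ^+ 3 + x.
Proof. by have := mulr_ge0 x_ge0 (sqr_ge0 (x - 1)); nra. Qed.

Let poly_rate (p c : R) : p <= c * (x ^+ 3 + x + 1) -> p * i <= c * rate.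
Proof. by rewrite /rate mulrA -/i => H; rewrite ler_pM2r. Qed.

Let stirn_le : stirling m.+1 <= expR (2 * i).
Proof. by apply: stirling_le; exact: leqW m_ge4. Qed.
Let stirn_ge : expR (- (2 * i)) <= stirling m.+1.
Proof. by apply: stirling_ge; exact: leqW m_ge. Qed.

Let rV : r^-1 <= 2 * i.
Proof.
have r0 : 0 < r by have := r_ge; have := s_gt0; lra.
rewrite -[r^-1]mul1r ler_pdivrMr//.
by have := ler_wpM2l (ltW i_gt0) r_ge; have := iE; lra.
Qed.

Let stirm_le : stirling m <= expR (4 * i).
Proof.
apply: le_trans (stirling_le m _) _; first exact: m_ge4.
by rewrite ler_expR -/r; have := rV; lra.
Qed.
Let stirm_ge : expR (- (4 * i)) <= stirling m.
Proof.
apply: le_trans (stirling_ge m _); last by [].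
by rewrite ler_expR lerN2 -/r; have := rV; lra.
Qed.

(** With 1 + h = (n + x s - 1) / n, the normal argument is s ln (1 + h), which
    is at least x - (x ^ 2 + 2) / s. *)
Lemma poisQ_upper L : n + x * s - 1 <= L ->
  poisQ m.+1 L <= ntail x * expR (7 * rate).
Proof.
move=> Ll; have s1 := s_ge; have x1 := x_le; have x0 := x_ge0.
have i0 := i_gt0; have iE' := iE; have xi0 := mulr_ge0 x0 (ltW i0).
pose h := (x - i) * i.
have hn : n * (1 + h) = n + x * s - 1.
  have -> : n * (1 + h) = n + (i * s) * (x * s) - (i * s) ^+ 2 by rewrite nE /h; ring.
  by rewrite iE; ring.
have h1 : - (i * i) <= h by rewrite /h; lra.
have i2 : i <= 100^-1 by rewrite lef_pV2 ?posrE//; lra.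
have h2 : - (2 / 5) <= h by nra.
have p1 : 0 < 1 + h by lra.
have n0 : 0 < n by rewrite nE; nra.
apply: (@le_trans _ _ (poisQ m.+1 (n * expR (ln (1 + h))))).
  by rewrite lnK ?posrE// hn poisQ_nincr// -hn mulr_ge0// ltW.
have ni : n^-1 = i ^+ 2 by rewrite nE /i exprVn.
apply: le_trans (poisQ_le_ntail m.+1 _ isT _) _.
  rewrite -/n ni; have := ln1p_ge _ h2.
  have [h0|h0] := leP 0 h.
    move=> _; have : 0 <= ln (1 + h) by apply: ln_ge0; rewrite lerDl.
    by have := sqr_ge0 i; lra.
  have : h ^+ 2 <= i ^+ 2 by nra.
  by nra.
rewrite -/n -/s ni.
have lo : x - (x ^+ 2 + 2) * i <= s * ln (1 + h).
  have : s * (h - h ^+ 2) <= s * ln (1 + h) by rewrite ler_wpM2l ?ln1p_ge//; lra.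
  have -> : s * (h - h ^+ 2) = x - i - (x - i) ^+ 2 * i.
    have -> : s * (h - h ^+ 2) = (i * s) * (x - i) - (i * s) * ((x - i) ^+ 2 * i).
      by rewrite /h; ring.
    by rewrite iE; ring.
  have : (x - i) ^+ 2 <= x ^+ 2 + 1 by nra.
  by nra.
have sh := ntail_shift (x - (x ^+ 2 + 2) * i) x.
have d0 : 0 <= (x ^+ 2 + 2) * i by rewrite mulr_ge0 ?(ltW i0)// addr_ge0// sqr_ge0.
have {}sh := le_trans (ntail_nincr _ _ lo) (sh ltac:(lra) x_ge0).
apply: le_trans (_ : expR (2 * i) * expR (2 * i) *
  (ntail x * expR ((x - (x - (x ^+ 2 + 2) * i)) * (x + 1))) <= _).
  apply: ler_pM => //.
  - by rewrite mulr_ge0 ?expR_ge0// ltW// stirling_gt0.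
  - exact/ltW/ntail_gt0.
  - apply: ler_pM; rewrite ?expR_ge0//; first by rewrite ltW// stirling_gt0.
    by rewrite ler_expR; nra.
rewrite mulrCA -!expRD ler_pM2l ?ntail_gt0// ler_expR.
apply: le_trans (_ : (4 + (x ^+ 2 + 2) * (x + 1)) * i <= _); first by lra.
by apply: poly_rate; have := x2; have := x3; lra.
Qed.

Let s_over_x : (x ^+ 2) * i <= x / 100.
Proof.
have := ler_wpM2l (mulr_ge0 x_ge0 (ltW i_gt0)) x_le.
have -> : x * i * (s / 100) = x * (i * s) / 100 by ring.
by rewrite iE mulr1 expr2 => H; lra.
Qed.

(** The normal argument is (x s + 1) / r <= x + (2 x + 2) / s. *)
Lemma poisQ_lower L : m%:R <= L -> L <= n + x * s ->
  ntail x * expR (- (16 * rate)) <= poisQ m.+1 L.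
Proof.
move=> mL Ll; have s1 := s_ge; have x1 := x_le; have x0 := x_ge0.
have i0 := i_gt0; have iE' := iE; have xi0 := mulr_ge0 x0 (ltW i0).
have r0 : 0 < r by have := r_ge; lra.
have rr := rE; have rlo := r_ge; have rhi := r_le; have rv := rV.
have m0 : (0 < m)%N by exact: leq_trans m_ge4.
pose y := (x * s + 1) / r.
have y0 : 0 <= y by rewrite /y divr_ge0 ?addr_ge0 ?mulr_ge0//; lra.
have yr : r * y = x * s + 1 by rewrite /y mulrC mulfVK// gt_eqF.
have E : n + x * s = m%:R + r * y by rewrite yr mE nE; ring.
apply: le_trans (_ : poisQ m.+1 (m%:R + r * y) <= _); last first.
  by rewrite -E; apply: poisQ_nincr => //; apply: le_trans mL.
apply: le_trans (poisQ_ge_ntail m y m0 y0).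
pose b := x + (2 * x + 2) * i.
have yb : y <= b.
  rewrite /y ler_pdivrMr// /b.
  have sr : s - r <= i.
    have : (s - r) * (s + r) = 1.
      have -> : (s - r) * (s + r) = s ^+ 2 - r ^+ 2 by ring.
      by rewrite rr; ring.
    have : (s - r) * s <= (s - r) * (s + r) by rewrite ler_wpM2l//; lra.
    by move=> A B; rewrite -(ler_pM2r s_gt0) iE; lra.
  have ir : 2^-1 <= i * r by have := ler_wpM2l (ltW i0) rlo; lra.
  have := ler_wpM2l x0 sr.
  have : 0 <= (2 * x + 2) by lra.
  move=> /ler_wpM2l/(_ _ _ ir).
  have : x * i <= x by rewrite ler_piMr//; nra.
  by lra.
have b0 : 0 <= b by lra.
have i2 : i <= 100^-1 by rewrite lef_pV2 ?posrE//; lra.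
have bx : b <= 2 * x + 1 by rewrite /b; nra.
have sh := ntail_shift x b; rewrite -/b in sh.
have xb : x <= b by rewrite /b lerDl mulr_ge0//; lra.
have {}sh := sh xb b0.
have E4 : expR (- (4 * i)) <= stirling m := stirm_ge.
have st0 : 0 < stirling m :> R := stirling_gt0 m m0.
apply: le_trans (_ : expR (- (4 * i)) * ntail b <= _); last first.
  apply: ler_pM; rewrite ?expR_ge0// ?(ltW (ntail_gt0 _))//.
  exact: ntail_nincr.
apply: le_trans (ler_wpM2r (expR_ge0 _) sh) _.
rewrite -mulrA -expRD mulrC ler_pM2r ?ntail_gt0// ler_expR.
have H1 : 4 * i <= 4 * rate.
  by apply: poly_rate; have := x3; lra.
suff : (b - x) * (b + 1) <= 12 * rate by lra.
apply: le_trans (_ : (4 * (x + 1) ^+ 2) * i <= _); last first.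
  by apply: poly_rate; have := x2; have := x3; lra.
have -> : 4 * (x + 1) ^+ 2 * i = ((2 * x + 2) * i) * (2 * x + 2) by ring.
have -> : b - x = (2 * x + 2) * i by rewrite /b; ring.
by rewrite ler_wpM2l//; lra.
Qed.

(** [poisQ_hazard] with c = s, where L >= s ^ 2 / 2. *)
Lemma pois_le_poisQ L : m%:R <= L -> L <= n + x * s ->
  4 * pois m L <= 8 * (x + 2) * i * poisQ m.+1 L.
Proof.
move=> mL Ll; have s1 := s_ge; have x1 := x_le; have x0 := x_ge0.
have L0 : 0 < L by apply: lt_le_trans mL; rewrite ltr0n (leq_trans _ m_ge4).
have i0 := i_gt0; have iE' := iE.
have Q0 := poisQ_ge0 m.+1 L (ltW L0).
have ms : m%:R <= s ^+ 2 by rewrite mE; lra.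
have := poisQ_hazard m s L s_gt0 ms mL.
have us : L - m%:R + s <= (x + 2) * s by rewrite mE; rewrite nE in Ll; lra.
have g0 := pois_ge0 m L (ltW L0).
have Ls : s ^+ 2 / 2 <= L by apply: le_trans mL; rewrite mE; have := ss_ge; lra.
move=> H.
have : s ^+ 2 / 2 * pois m L <= poisQ m.+1 L * ((x + 2) * s).
  apply: le_trans (_ : L * pois m L <= _); first by rewrite ler_wpM2r.
  by apply: le_trans H _; rewrite ler_wpM2l.
have i20 : 0 <= 8 * i ^+ 2 by rewrite mulr_ge0 ?sqr_ge0.
move=> /(ler_wpM2l i20).
have -> : 8 * i ^+ 2 * (s ^+ 2 / 2 * pois m L) = 4 * (i * s) ^+ 2 * pois m L by field.
have -> : 8 * i ^+ 2 * (poisQ m.+1 L * ((x + 2) * s)) = 8 * (x + 2) * i * (i * s) * poisQ m.+1 L by ring.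
by rewrite iE expr1n !mulr1.
Qed.

(** With 1 + h = (n - x s - 1) / n, the normal argument is - s ln (1 + h), which
    is at most x + (1 + (x + 1) ^ 2) / s. *)
Lemma poisB_lower L : 0 <= L -> n - x * s - 1 <= L ->
  ntail x * expR (- (16 * rate)) <= poisB m.+1 L.
Proof.
move=> L0 Ll; have s1 := s_ge; have x1 := x_le; have x0 := x_ge0.
have i0 := i_gt0; have iE' := iE; have xi0 := mulr_ge0 x0 (ltW i0).
pose h := - ((x + i) * i).
have hn : n * (1 + h) = n - x * s - 1.
  have -> : n * (1 + h) = n - (i * s) * (x * s) - (i * s) ^+ 2 by rewrite nE /h; ring.
  by rewrite iE; ring.
have i2 : i <= 100^-1 by rewrite lef_pV2 ?posrE//; lra.
have xi : x * i <= 100^-1.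
  have := ler_wpM2l (ltW i0) x1.
  have -> : i * (s / 100) = (i * s) / 100 by ring.
  by rewrite iE; lra.
have h2 : - (2 / 5) <= h by rewrite /h; nra.
have h0 : h <= 0 by rewrite /h oppr_le0 mulr_ge0 ?(ltW i0)//; lra.
have p1 : 0 < 1 + h by lra.
have n0 : 0 < n by rewrite nE; have := ss_ge; lra.
apply: (@le_trans _ _ (poisB m.+1 (n * expR (ln (1 + h))))); last first.
  rewrite lnK ?posrE// hn /poisB lerD2l lerN2; apply: poisQ_nincr => //.
  by rewrite -hn mulr_ge0// ltW.
have lh0 : ln (1 + h) <= 0 by apply: ln_le0; lra.
apply: le_trans (poisB_ge_ntail m.+1 _ isT lh0); rewrite -/n -/s.
pose b := x + (1 + (x + 1) ^+ 2) * i.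
have lo : - (s * ln (1 + h)) <= b.
  have : s * (h - h ^+ 2) <= s * ln (1 + h) by rewrite ler_wpM2l ?ln1p_ge//; lra.
  have -> : s * (h - h ^+ 2) = - (x + i) - (x + i) ^+ 2 * i.
    have -> : s * (h - h ^+ 2) = - ((i * s) * (x + i)) - (i * s) * ((x + i) ^+ 2 * i).
      by rewrite /h; ring.
    by rewrite iE; ring.
  have : (x + i) ^+ 2 <= (x + 1) ^+ 2 by nra.
  by rewrite /b; nra.
have d0 : 0 <= (1 + (x + 1) ^+ 2) * i by rewrite mulr_ge0 ?(ltW i0)// addr_ge0// sqr_ge0.
have b0 : 0 <= b by rewrite /b; lra.
have bx : b + 1 <= 2 * x + 2 by have := s_over_x; rewrite /b; nra.
have xb : x <= b by rewrite /b lerDl.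
have sh := ntail_shift x b xb b0.
have E4 : expR (- (2 * i)) <= stirling m.+1 := stirn_ge.
apply: le_trans (_ : expR (- (2 * i)) * ntail b <= _); last first.
  apply: ler_pM; rewrite ?expR_ge0// ?(ltW (ntail_gt0 _))//.
  exact: ntail_nincr.
apply: le_trans (ler_wpM2r (expR_ge0 _) sh) _.
rewrite -mulrA -expRD mulrC ler_pM2r ?ntail_gt0// ler_expR.
have H1 : 2 * i <= 2 * rate.
  by apply: poly_rate; have := x3; lra.
suff : (b - x) * (b + 1) <= 14 * rate by lra.
apply: le_trans (_ : ((1 + (x + 1) ^+ 2) * (2 * x + 2)) * i <= _); last first.
  by apply: poly_rate; have := x2; have := x3; lra.
have -> : b - x = (1 + (x + 1) ^+ 2) * i by rewrite /b; ring.
by rewrite [leRHS]mulrAC ler_wpM2l.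
Qed.

(** The normal argument is (x s - 1) / r >= x - 2 / s. *)
Lemma poisB_upper L : 0 <= L -> L <= n - x * s ->
  poisB m.+1 L <= ntail x * expR (8 * rate).
Proof.
move=> L0 Ll; have s1 := s_ge; have x1 := x_le; have x0 := x_ge0.
have i0 := i_gt0; have iE' := iE; have xi0 := mulr_ge0 x0 (ltW i0).
have r0 : 0 < r by have := r_ge; lra.
have rr := rE; have rlo := r_ge; have rhi := r_le; have rv := rV.
have m0 : (0 < m)%N by exact: leq_trans m_ge4.
pose y := (1 - x * s) / r.
have yr : r * y = 1 - x * s by rewrite /y mulrC mulfVK// gt_eqF.
have E : n - x * s = m%:R + r * y by rewrite yr mE nE; ring.
have xs : x * s <= s ^+ 2 / 100.
  by have := ler_wpM2r (ltW s_gt0) x1; rewrite expr2; lra.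
have ss := ss_ge.
apply: le_trans (_ : poisB m.+1 (m%:R + r * y) <= _).
  by rewrite -E /poisB lerD2l lerN2; apply: poisQ_nincr.
apply: le_trans (poisB_le_ntail m y m0 _ _) _.
- rewrite -/r -(ler_pM2l r0) yr mulrN -expr2 rr; lra.
- by rewrite -/r /y -[leRHS]mul1r ler_pM2r ?invr_gt0// gerBl mulr_ge0//; lra.
pose a := x - 2 * i.
have ya : a <= - y.
  have : x - r^-1 <= - y.
    rewrite -(ler_pM2l r0) mulrN yr mulrBr divff ?gt_eqF//.
    by have := ler_wpM2l x0 rhi; lra.
  by rewrite /a; lra.
have ax : a <= x by rewrite /a; lra.
have sh := le_trans (ntail_nincr _ _ ya) (ntail_shift a x ax x0).
have st0 : 0 < stirling m :> R := stirling_gt0 m m0.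
have E1 : expR (2 * m%:R)^-1 <= expR (2 * i).
  rewrite ler_expR invfM -[X in (_ * X)%R]/(m%:R^-1).
  have -> : (m%:R^-1 : R) = r^-1 * r^-1 by rewrite -invfM -expr2 rr mE.
  have ri0 : 0 < r^-1 by rewrite invr_gt0.
  have i2 : i <= 100^-1 by rewrite lef_pV2 ?posrE//; lra.
  by nra.
apply: le_trans (_ : expR (4 * i) * expR (2 * i) *
   (ntail x * expR ((x - a) * (x + 1))) <= _).
  apply: ler_pM => //.
  - exact: mulr_ge0 (ltW st0) (expR_ge0 _).
  - exact/ltW/ntail_gt0.
  - by apply: ler_pM; rewrite ?expR_ge0// ?(ltW st0)//; exact: stirm_le.
rewrite mulrCA -!expRD ler_pM2l ?ntail_gt0// ler_expR.
have -> : x - a = 2 * i by rewrite /a; ring.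
apply: le_trans (_ : (6 + 2 * (x + 1)) * i <= _); first by lra.
by apply: poly_rate; have := x3; lra.
Qed.

(** [poisB_hazard_rate] with c = s + 1, where L >= s ^ 2 / 2. *)
Lemma pois_le_poisB L : n - x * s - 1 <= L -> 0 < L -> L <= n ->
  pois m L <= 2 * (x + 2) * i * poisB m.+1 L.
Proof.
move=> mL L0 Ll; have s1 := s_ge; have x1 := x_le; have x0 := x_ge0.
have i0 := i_gt0; have iE' := iE.
have B0 := poisB_ge0 m.+1 L (ltW L0).
have ms : m.+1%:R <= (s + 1 - 1) ^+ 2 by rewrite addrK -nE.
have c1 : 1 < s + 1 by lra.
have := poisB_hazard_rate m (s + 1) L c1 ms (ltW L0) Ll.
rewrite nE in mL Ll.
have us : m%:R - L + (s + 1) <= (x + 2) * s by rewrite mE; lra.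
have g0 := pois_ge0 m L (ltW L0).
have xs : x * s <= s ^+ 2 / 100.
  by have := ler_wpM2r (ltW s_gt0) x1; rewrite expr2; lra.
have Ls : s ^+ 2 / 2 <= L by have := ss_ge; lra.
move=> H.
have : s ^+ 2 / 2 * pois m L <= poisB m.+1 L * ((x + 2) * s).
  apply: le_trans (_ : L * pois m L <= _); first by rewrite ler_wpM2r.
  by apply: le_trans H _; rewrite ler_wpM2l.
have i20 : 0 <= 2 * i ^+ 2 by rewrite mulr_ge0 ?sqr_ge0.
move=> /(ler_wpM2l i20).
have -> : 2 * i ^+ 2 * (s ^+ 2 / 2 * pois m L) = (i * s) ^+ 2 * pois m L by field.
have -> : 2 * i ^+ 2 * (poisB m.+1 L * ((x + 2) * s)) = 2 * (x + 2) * i * (i * s) * poisB m.+1 L by ring.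
by rewrite iE expr1n !mulr1 mul1r.
Qed.

Let xi_small : (x + 2) * i <= 3 / 100.
Proof.
have := ler_wpM2l (ltW i_gt0) x_le.
have -> : i * (s / 100) = (i * s) / 100 by ring.
have : i <= 100^-1 by rewrite lef_pV2 ?posrE.
by rewrite iE; lra.
Qed.

Let xi_rate (c : R) : 0 <= c -> c * (x + 2) * i <= 2 * c * rate.
Proof.
move=> c0; apply: poly_rate; have := x3 => y3; have := x_ge0 => y0.
have := mulr_ge0 c0 y3; have := mulr_ge0 c0 y0.
by nra.
Qed.

Lemma engel_tail_bounds N : (0 < N)%N ->
  n + x * s - 1 <= harm N -> harm N <= n + x * s ->
  ntail x * expR (- (48 * rate)) <= engel_tail m.+1 N <= ntail x * expR (48 * rate).
Proof.
move=> N0 L1 L2; have xs : 0 <= x * s by rewrite mulr_ge0.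
have mL : m%:R <= harm N :> R by rewrite mE; rewrite nE in L1; lra.
have L0 : 0 <= harm N :> R by apply: le_trans mL.
have rate0 : 0 <= rate by rewrite divr_ge0// addr_ge0// addr_ge0.
apply/andP; split; last first.
  apply: le_trans (engel_tail_le m N N0 L0) _.
  apply: le_trans (poisQ_upper _ L1) _.
  by rewrite ler_pM2l ?ntail_gt0// ler_expR; lra.
apply: le_trans (engel_tail_ge m N N0 mL).
have g := pois_le_poisQ _ mL L2.
apply: le_trans (_ : (1 - 8 * (x + 2) * i) * poisQ m.+1 (harm N) <= _); last by lra.
have e01 : 0 <= 8 * (x + 2) * i <= 2^-1.
  apply/andP; split; first by rewrite mulr_ge0 ?mulr_ge0 ?addr_ge0 ?(ltW i_gt0).
  by have := xi_small; lra.
have -> : 48 * rate = 2 * (8 * (x + 2) * i) + 16 * rate + (32 * rate - 16 * (x + 2) * i) by ring.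
apply: le_trans (_ : expR (- (2 * (8 * (x + 2) * i))) * (ntail x * expR (- (16 * rate))) <= _).
  rewrite [leRHS]mulrCA -expRD ler_pM2l ?ntail_gt0// ler_expR.
  by have := xi_rate 16 (ler0n _ _); lra.
apply: ler_pM; rewrite ?expR_ge0//.
- by rewrite mulr_ge0 ?expR_ge0// ltW// ntail_gt0.
- exact: expRN2_le_onem.
- exact: poisQ_lower.
Qed.

Lemma engel_head_bounds N : (0 < N)%N ->
  n - x * s - 1 <= harm N -> harm N <= n - x * s ->
  ntail x * expR (- (48 * rate)) <= 1 - engel_tail m.+1 N <= ntail x * expR (48 * rate).
Proof.
move=> N0 L1 L2; have xs0 : 0 <= x * s by rewrite mulr_ge0.
have xs : x * s <= s ^+ 2 / 100.
  by have := ler_wpM2r (ltW s_gt0) x_le; rewrite expr2; lra.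
have L0 : 0 < harm N :> R by rewrite nE in L1; have := ss_ge; lra.
have rate0 : 0 <= rate by rewrite divr_ge0// addr_ge0// addr_ge0.
have B0 := poisB_gt0 m.+1 _ L0.
have Ln : harm N <= n by lra.
apply/andP; split.
  have := engel_tail_le m N N0 (ltW L0); have := poisB_lower _ (ltW L0) L1.
  have : ntail x * expR (- (48 * rate)) <= ntail x * expR (- (16 * rate)).
    by rewrite ler_pM2l ?ntail_gt0// ler_expR; lra.
  by rewrite /poisB; lra.
have g := pois_le_poisB _ L1 L0 Ln.
have g' : pois m (harm N) <= 2^-1 * poisB m.+1 (harm N) :> R.
  apply: le_trans g _; rewrite ler_pM2r//; have := xi_small; lra.
apply: le_trans (engel_head_le m N N0 L0 g') _.
apply: le_trans (_ : expR (8 * rate) * (ntail x * expR (8 * rate)) <= _).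
  apply: ler_pM; rewrite ?expR_ge0// ?(ltW B0)//; last exact: poisB_upper (ltW L0) L2.
  rewrite ler_expR.
  have : pois m (harm N) / poisB m.+1 (harm N) <= 2 * (x + 2) * i :> R by rewrite ler_pdivrMr.
  by have := xi_rate 4 (ler0n _ _); lra.
by rewrite [leLHS]mulrCA -expRD ler_pM2l ?ntail_gt0// ler_expR; lra.
Qed.

Lemma rate_le_Delta : rate <= Delta m.+1 x.
Proof.
rewrite /Delta -/n -/s -mulrDl ler_pM2r ?invr_gt0//.
have : 1 <= ln n.
  rewrite -ler_expR lnK; last by rewrite posrE nE exprn_gt0.
  have := expR_ge1Dx (- (1 / 2) : R); rewrite expRN.
  have e0 := expR_gt0 (1 / 2 : R).
  have -> : expR 1 = expR (1 / 2) * expR (1 / 2) :> R by rewrite -expRD; congr expR; lra.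
  rewrite nE; have := ss_ge.
  move: (expR (1 / 2)) e0 => e e0 ss H.
  have e1 : e * e^-1 = 1 by rewrite divff// gt_eqF.
  have e2 : e <= 2 by nra.
  by nra.
move=> l1; have := ler_wpM2l (_ : 0 <= 1 + x) l1.
by rewrite mulr1 => /(_ (addr_ge0 ler01 x_ge0)); lra.
Qed.

End TailEstimates.

(** * From digits to the normalised variables *)

Section EngelY.
Context {R : realType}.

Lemma lne_ratio_le (p x c : R) :
  ntail x * expR (- c) <= p <= ntail x * expR c ->
  (`| lne (p%:E / Phibar x) | <= c%:E)%E.
Proof.
move=> /andP[p1 p2]; have x0 := ntail_gt0 x.
have p0 : 0 < p by apply: lt_le_trans p1; rewrite mulr_gt0 ?expR_gt0.
have q0 : 0 < p / ntail x by rewrite divr_gt0.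
rewrite PhibarE inver gt_eqF// -EFinM lne_EFin// abse_EFin lee_fin ler_norml.
apply/andP; split; rewrite -ler_expR lnK ?posrE//.
  by rewrite ler_pdivlMr// mulrC.
by rewrite ler_pdivrMr// mulrC.
Qed.

Lemma engel_digit_ge2 n (w : R) : (2 <= engel_digit n w)%N.
Proof.
rewrite /engel_digit; have [w01|w01] := boolP (0 < w <= 1).
  by have [] := engel_expansionP _ w01.
by rewrite engel_expansion_out.
Qed.

Let sqrt_gt0 n : (0 < n)%N -> 0 < Num.sqrt n%:R :> R.
Proof. by move=> n0; rewrite sqrtr_gt0 ltr0n. Qed.

Let digit_pos n (w : R) : (engel_digit n w)%:R \is @Num.pos R.
Proof. by rewrite posrE ltr0n (leq_trans _ (engel_digit_ge2 n w)). Qed.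

Lemma engelY_gt n (w x : R) : (0 < n)%N ->
  (x < engelY n w) = (expR (n%:R + x * Num.sqrt n%:R) < (engel_digit n w)%:R).
Proof.
move=> n0; rewrite /engelY ltr_pdivlMr ?sqrt_gt0// ltrBrDl.
by rewrite -[LHS]ltr_expR lnK ?digit_pos.
Qed.

Lemma engelY_lt n (w x : R) : (0 < n)%N ->
  (engelY n w < - x) = ((engel_digit n w)%:R < expR (n%:R - x * Num.sqrt n%:R)).
Proof.
move=> n0; rewrite /engelY ltr_pdivrMr ?sqrt_gt0// ltrBlDl.
by rewrite -[LHS]ltr_expR lnK ?digit_pos// mulNr.
Qed.

Lemma engelY_le n (w x : R) : (0 < n)%N ->
  (engelY n w <= - x) = ((engel_digit n w)%:R <= expR (n%:R - x * Num.sqrt n%:R)).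
Proof.
move=> n0; rewrite /engelY ler_pdivrMr ?sqrt_gt0// lerBlDl.
by rewrite -[LHS]ler_expR lnK ?digit_pos// mulNr.
Qed.

(** The sum of 1/k over 2 <= k <= N lies between ln (N + 1) - 1 and ln N. *)
Lemma harm_within1 (t : R) N : (0 < N)%N -> N%:R <= expR t -> expR t <= N.+1%:R ->
  t - 1 <= harm N /\ harm N <= t.
Proof.
move=> N0 N1 N2; have NR : 0 < N%:R :> R by rewrite ltr0n.
split.
  apply: le_trans (harm_ge N N0); rewrite lerD2r -[t]expRK.
  by rewrite ler_ln ?posrE ?expR_gt0.
by apply: le_trans (harm_le N N0) _; rewrite -[t]expRK ler_ln ?posrE ?expR_gt0.
Qed.

End EngelY.

(* [lne] is the logarithm with values in the extended reals and lne 0 = -oo, so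
   the bounds below fail for a vanishing probability. *)
Theorem theorem2p1 (R : realType) :
  exists C : R, 0 < C /\
  forall b : nat -> R,
    (forall n, (1 <= n)%N -> 0 < b n) ->
    b =o_\oo (fun n : nat => Num.sqrt (n%:R : R)) ->
    exists n0 : nat, forall (n : nat) (x : R),
      (n0 <= n)%N -> 0 <= x -> x <= b n ->
      [/\ (`| lne (unif01 R [set w | (engelY n w > x)%R] / Phibar x) |
             <= (C * Delta n x)%:E)%E,
          (`| lne (unif01 R [set w | (engelY n w < - x)%R] / Phibar x) |
             <= (C * Delta n x)%:E)%E &
          (`| lne (unif01 R [set w | (engelY n w <= - x)%R] / Phibar x) |
             <= (C * Delta n x)%:E)%E].
Proof.
(* 48 is the constant of [engel_tail_bounds], the worst of the two sides; the
   smallness of b n / sqrt n is used with the threshold 1/100 only. *)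
exists 48; split => // b b0 bo.
have b_small : \forall n \near \oo, `|b n| <= 100^-1 * `|Num.sqrt (n%:R : R)|.
  by move/eqoP: bo; apply.
have [n1 _ Hn1] := b_small.
exists (maxn n1 (100 * 100)) => n x; rewrite geq_max => /andP[n1n n100] x0 xb.
have s100 : 100 <= Num.sqrt n%:R :> R.
  rewrite -ler_sqr ?nnegrE// sqr_sqrtr// expr2 -natrM ler_nat//.
case: n n1n n100 s100 xb => // m n1n n100 s100 xb.
have xs : x <= Num.sqrt m.+1%:R / 100.
  have := Hn1 m.+1 n1n; rewrite [`|Num.sqrt _|]ger0_norm// mulrC.
  by apply: le_trans; apply: le_trans xb _; exact: ler_norm.
set s : R := Num.sqrt m.+1%:R in s100 xs *.
have rD := rate_le_Delta m x s100 x0.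
have up p : ntail x * expR (- (48 * rate m x)) <= p <= ntail x * expR (48 * rate m x) ->
    (`| lne (p%:E / Phibar x) | <= (48 * Delta m.+1 x)%:E)%E.
  move=> /lne_ratio_le H; apply: le_trans H _; rewrite lee_fin.
  by rewrite ler_pM2l.
(* Both left tails are events q_n <= N with N the largest integer below
   exp(n - x sqrt n), strictly or not. *)
have head N : (1 < N)%N -> N%:R <= expR (m.+1%:R - x * s) ->
    expR (m.+1%:R - x * s) <= N.+1%:R ->
    (`| lne (unif01 R [set w | (engel_digit m.+1 w <= N)%N] / Phibar x) |
      <= (48 * Delta m.+1 x)%:E)%E.
  move=> N1 Nl Nu; have [mN uN] := @engel_digit_tail R m.+1 N isT N1.
  have -> : [set w : R | (engel_digit m.+1 w <= N)%N] =
      ~` [set w | (N < engel_digit m.+1 w)%N].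
    by apply/seteqP; split => w /=; rewrite ltnNge; [move=> -> | move/negP/negPn].
  rewrite probability_setC// uN -EFinB; apply: up.
  have [h1 h2] := harm_within1 _ _ (ltnW N1) Nl Nu.
  exact: (engel_head_bounds m x s100 x0 xs N (ltnW N1) h1 h2).
have n_ge : 100 * 100 <= m.+1%:R :> R by rewrite -natrM ler_nat.
have ss : m.+1%:R = s * s :> R by rewrite -expr2 sqr_sqrtr.
have xss : 0 <= x * s <= m.+1%:R / 100.
  rewrite ss mulr_ge0 ?sqrtr_ge0//= mulrAC ler_pM2r//; lra.
have big (t : R) : m.+1%:R / 2 <= t -> 3 <= expR t.
  by move=> t2; apply: le_trans (expR_ge1Dx t); lra.
have /andP[xs0 xs1] := xss.
split.
- have t0 := expR_ge0 (m.+1%:R + x * s).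
  have /andP[N1 N2] := truncn_itv t0.
  set N := Num.truncn _ in N1 N2.
  have t3 : 3 <= expR (m.+1%:R + x * s) by apply: big; lra.
  have NN : (1 < N)%N by rewrite -ltnS -(ltr_nat R); apply: lt_trans N2; lra.
  have [mN uN] := @engel_digit_tail R m.+1 N isT NN.
  have -> : [set w : R | x < engelY m.+1 w] = [set w | (N < engel_digit m.+1 w)%N].
    apply/seteqP; split => w /=; rewrite engelY_gt// -/s.
      by move/(le_lt_trans N1); rewrite ltr_nat.
    by move=> Nw; apply: lt_le_trans N2 _; rewrite ler_nat.
  rewrite uN; apply: up.
  have [h1 h2] := harm_within1 _ _ (ltnW NN) N1 (ltW N2).
  exact: (engel_tail_bounds m x s100 x0 xs N (ltnW NN) h1 h2).
- set y := expR (m.+1%:R - x * s).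
  have y3 : 3 <= y by apply: big; lra.
  (* The largest integer strictly below y: it differs from the integer part of y
     when y is an integer. *)
  have [N [N1 N2]] : exists N, N%:R < y /\ y <= N.+1%:R.
    have y0 : 0 <= y by exact: expR_ge0.
    have /andP[N1 N2] := truncn_itv y0.
    move: N1; rewrite le_eqVlt => /orP[/eqP E|N1]; last first.
      by exists (Num.truncn y); split => //; exact: ltW.
    have K0 : (0 < Num.truncn y)%N by rewrite -(ltr_nat R) E; lra.
    exists (Num.truncn y).-1; rewrite prednK//; split; last by rewrite E.
    by rewrite -[ltRHS]E ltr_nat prednK.
  have NN : (1 < N)%N by rewrite -ltnS -(ltr_nat R); apply: lt_le_trans N2; lra.
  have -> : [set w : R | engelY m.+1 w < - x] = [set w | (engel_digit m.+1 w <= N)%N].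
    apply/seteqP; split => w /=; rewrite engelY_lt// -/s -/y.
      by move=> /lt_le_trans/(_ N2); rewrite ltr_nat ltnS.
    by move=> Nw; apply: le_lt_trans N1; rewrite ler_nat.
  exact: head NN (ltW N1) N2.
- have t0 := expR_ge0 (m.+1%:R - x * s).
  have /andP[N1 N2] := truncn_itv t0.
  set N := Num.truncn _ in N1 N2.
  have t3 : 3 <= expR (m.+1%:R - x * s) by apply: big; lra.
  have NN : (1 < N)%N by rewrite -ltnS -(ltr_nat R); apply: lt_trans N2; lra.
  have -> : [set w : R | engelY m.+1 w <= - x] = [set w | (engel_digit m.+1 w <= N)%N].
    apply/seteqP; split => w /=; rewrite engelY_le// -/s.
      by move=> /le_lt_trans/(_ N2); rewrite ltr_nat ltnS.
    by move=> Nw; apply: le_trans N1; rewrite ler_nat.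
  exact: head NN N1 (ltW N2).
Qed.
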